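(* The category $\mathsf{Graph}$ of graphs and graph maps carries a fibration category structure in which: (a) the weak equivalences are the weak homotopy equivalences, i.e. the maps $f\colon G\to H$ such that, for all vertices $v$ of $G$ and all $n\ge 0$, the map $A_nf\colon A_n(G,v)\to A_n(H,f(v))$ is an isomorphism; (b) the fibrations are the maps $f\colon G\to H$ which are sent to Kan fibrations $\mathrm{N}f\colon\mathrm{N}G\to\mathrm{N}H$ of cubical sets under the nerve functor $\mathrm{N}$ from graphs to cubical sets.
   Context: Graphs. A graph is a (possibly infinite) simple undirected graph without loops; write $v\sim w$ if $v,w$ are equal or joined by an edge. A graph map $f\colon G\to H$ is a function on vertices such that $v\sim w$ implies $f(v)\sim f(w)$. The product $G\otimes H$ has as vertices the pairs $(v,w)$, with $(v,w)\sim(v',w')$ iff ($v=v'$ and $w\sim w'$) or ($w=w'$ and $v\sim v'$); $G^{\otimes n}$ is the $n$-fold product, and $G^{\otimes 0}$ is the one-vertex graph. $I_m$ has vertices $0,\dots,m$ and edges between $i$ and $i+1$; $I_\infty$ has vertex set $\mathbb{Z}$ and edges between $i$ and $i+1$. A-groups. For $n,M\ge0$ let $I^{\otimes n}_{\ge M}$ be the subgraph of $I_\infty^{\otimes n}$ on the vertices with $|v_i|\ge M$ for some $i=1,\dots,n$ (it is empty for $n=0$). For a vertex $v$ of $G$, consider graph maps $f\colon I_\infty^{\otimes n}\to G$ which are constant at $v$ on $I^{\otimes n}_{\ge M}$ for some $M\ge 0$. A based homotopy from $f$ to $g$ is a graph map $\eta\colon I_\infty^{\otimes n}\otimes I_m\to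 G$, for some $m\ge0$, restricting to $f$ on $I_\infty^{\otimes n}\otimes\{0\}$, to $g$ on $I_\infty^{\otimes n}\otimes\{m\}$, and constant at $v$ on $I^{\otimes n}_{\ge K}\otimes I_m$ for some $K$. For $n\ge0$, $A_n(G,v)$ is the set of based homotopy classes of such maps; thus $A_0(G,v)$ is the set of connected components of $G$, and for $n\ge1$ $A_n(G,v)$ is a group under concatenation in a coordinate direction. The map $A_nf$ is induced by postcomposition with $f$; isomorphism means bijection for $n=0$ and group isomorphism for $n\ge1$. Cubical sets. The box category $\square$ has objects the posets $[1]^n=\{0\le1\}^n$, $n\ge0$, with morphisms generated by: faces $\partial_{i,\varepsilon}\colon[1]^{n-1}\to[1]^n$ inserting $\varepsilon\in\{0,1\}$ in position $i$; degeneracies $\sigma_i\colon[1]^n\to[1]^{n-1}$ deleting the $i$-th coordinate; connections $\gamma_{i,0},\gamma_{i,1}\colon[1]^n\to[1]^{n-1}$ replacing $x_i,x_{i+1}$ by their max and min respectively. A cubical set is a presheaf $X$ of sets on $\square$, with operators acting on the right; a cubical map is a natural transformation. $\square^n$ is the presheaf represented by $[1]^n$; the open box $\sqcap^n_{i,\varepsilon}\subseteq\square^n$ ($n\ge1$, $1\le i\le n$, $\varepsilon\in\{0,1\}$) is the union of the images of all faces $\partial_{j,\eta}$ with $(j,\eta)\ne(i,\varepsilon)$. A Kan fibration is a cubical map with the right lifting property with respect to all open box inclusions $\sqcap^n_{i,\varepsilon}\hookrightarrow\square^n$. Nerve. A graph map $f\colon I_\infty^{\otimes n}\to G$ is stable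 in all directions if there is $M\ge0$ such that, for every $i=1,\dots,n$, the value of $f$ is unchanged when a coordinate $v_i>M$ is replaced by $M$ and when a coordinate $v_i<-M$ is replaced by $-M$. $\mathrm{N}G$ is the cubical set with $(\mathrm{N}G)_n$ the set of such maps, where $f\partial_{i,\varepsilon}$ is obtained by setting the $i$-th coordinate of $f$ equal to $(2\varepsilon-1)M$ for $M$ as in the stability condition, $f\sigma_i(v_1,\dots,v_{n+1})=f(v_1,\dots,v_{i-1},v_{i+1},\dots,v_{n+1})$, and $f\gamma_{i,0}$, $f\gamma_{i,1}$ send $(v_1,\dots,v_{n+1})$ to $f(v_1,\dots,v_{i-1},\max(v_i,v_{i+1}),v_{i+2},\dots,v_{n+1})$ and $f(v_1,\dots,v_{i-1},\min(v_i,v_{i+1}),v_{i+2},\dots,v_{n+1})$ respectively; $\mathrm{N}$ acts on graph maps by postcomposition. Fibration category. A fibration category is a category $\mathscr{C}$ with two subcategories, of fibrations and of weak equivalences, such that (an acyclic fibration being a map that is both): (1) weak equivalences satisfy two-out-of-three; (2) all isomorphisms are acyclic fibrations; (3) pullbacks along fibrations exist, and fibrations and acyclic fibrations are stable under pullback; (4) $\mathscr{C}$ has a terminal object $1$, and $X\to1$ is a fibration for every object $X$; (5) every map factors as a weak equivalence followed by a fibration.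
   Formalization: Weak homotopy equivalences $f\colon G\to H$ are also required to have $G$ non-empty whenever $H$ is; read literally, every map out of the empty graph would be a weak equivalence and two-out-of-three would fail for $\emptyset\to\{a,b\}\to 1$. *)

(* Defs.v *)
From Stdlib Require Import FunctionalExtensionality PropExtensionality.
From Stdlib Require Import ProofIrrelevance ClassicalEpsilon.
From mathcomp Require Import all_boot all_order all_algebra.
From mathcomp Require Import zify.

Set Implicit Arguments.
Unset Strict Implicit.
Unset Printing Implicit Defensive.

Import Order.TTheory GRing.Theory Num.Theory.
Local Open Scope ring_scope.

(** * Categories *)

Record category := Category {
  ob :> Type;
  hom : ob -> ob -> Type;
  idm : forall X, hom X X;
  compm : forall X Y Z, hom Y Z -> hom X Y -> hom X Z;
  comp1m : forall X Y (f : hom X Y), compm (idm Y) f = f;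
  compm1 : forall X Y (f : hom X Y), compm f (idm X) = f;
  compA : forall W X Y Z (h : hom Y Z) (g : hom X Y) (f : hom W X),
    compm h (compm g f) = compm (compm h g) f }.

Arguments hom {c} X Y.
Arguments idm {c} X.
Arguments compm {c X Y Z} g f.
Notation "g '\oc' f" := (compm g f) (at level 40, left associativity).

Record functor (C D : category) := Functor {
  fob :> C -> D;
  fmap : forall X Y, hom X Y -> hom (fob X) (fob Y);
  fmap1 : forall X, fmap (idm X) = idm (fob X);
  fmapM : forall X Y Z (g : hom Y Z) (f : hom X Y),
    fmap (g \oc f) = fmap g \oc fmap f }.

Arguments fmap {C D} f {X Y} _ : rename.

Definition mclass (C : category) := forall X Y : C, hom X Y -> Prop.

Section CategoryTheory.
Variable C : category.
Implicit Types X Y Z A B E P : C.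

Definition is_iso X Y (f : hom X Y) :=
  exists g : hom Y X, g \oc f = idm X /\ f \oc g = idm Y.

Definition is_terminal T := forall X, exists! f : hom X T, True.

Definition is_pullback P A E B
    (q : hom P A) (g : hom P E) (f : hom A B) (p : hom E B) :=
  f \oc q = p \oc g /\
  forall X (a : hom X A) (e : hom X E), f \oc a = p \oc e ->
    exists! u : hom X P, q \oc u = a /\ g \oc u = e.

Definition rlp A B X Y (i : hom A B) (p : hom X Y) :=
  forall (u : hom A X) (w : hom B Y), p \oc u = w \oc i ->
    exists l : hom B X, l \oc i = u /\ p \oc l = w.

Definition is_subcategory (S : mclass C) :=
  (forall X, S X X (idm X)) /\
  forall X Y Z (g : hom Y Z) (f : hom X Y), S Y Z g -> S X Y f -> S X Z (g \oc f).

Definition two_out_of_three (S : mclass C) :=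
  forall X Y Z (g : hom Y Z) (f : hom X Y),
    [/\ S X Y f -> S Y Z g -> S X Z (g \oc f),
        S X Y f -> S X Z (g \oc f) -> S Y Z g &
        S Y Z g -> S X Z (g \oc f) -> S X Y f].

Definition pullback_stable (S : mclass C) :=
  forall P A E B (q : hom P A) (g : hom P E) (f : hom A B) (p : hom E B),
    is_pullback q g f p -> S E B p -> S P A q.

Record fibration_category (fib weq : mclass C) : Prop := FibrationCategory {
  fib_subcat : is_subcategory fib;
  weq_subcat : is_subcategory weq;
  weq_2of3 : two_out_of_three weq;
  iso_acyclic_fib : forall X Y (f : hom X Y), is_iso f -> fib X Y f /\ weq X Y f;
  fib_pullback : forall A E B (f : hom A B) (p : hom E B), fib E B p ->
    exists P (q : hom P A) (g : hom P E), is_pullback q g f p;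
  fib_stable : pullback_stable fib;
  acyclic_fib_stable : pullback_stable (fun X Y f => fib X Y f /\ weq X Y f);
  terminal_fib : exists T, is_terminal T /\ forall X (f : hom X T), fib X T f;
  factorization : forall X Y (f : hom X Y),
    exists Z (w : hom X Z) (p : hom Z Y), [/\ f = p \oc w, weq X Z w & fib Z Y p] }.

(** ** Presheaves *)

Record presheaf := Presheaf {
  sec :> C -> Type;
  act : forall X Y, sec Y -> hom X Y -> sec X;
  act1 : forall X (x : sec X), act x (idm X) = x;
  actM : forall X Y Z (x : sec Z) (g : hom Y Z) (f : hom X Y),
    act x (g \oc f) = act (act x g) f }.

Record nat_trans (F G : presheaf) := NatTrans {
  nt :> forall X, F X -> G X;
  nt_nat : forall X Y (x : F Y) (f : hom X Y), nt (act x f) = act (nt x) f }.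

Lemma nat_trans_eq (F G : presheaf) (s t : nat_trans F G) :
  (forall X (x : F X), s X x = t X x) -> s = t.
Proof.
case: s t => [s sn] [t tn] /= e.
have es : s = t.
  apply: functional_extensionality_dep => X.
  exact: functional_extensionality_dep.
by case: t / es tn {e} => tn; rewrite (proof_irrelevance _ sn tn).
Qed.

Lemma nt_id_nat (F : presheaf) X Y (x : F Y) (f : hom X Y) : act x f = act x f.
Proof. by []. Qed.

Definition nt_id F : nat_trans F F := NatTrans (nt := fun X x => x) (@nt_id_nat F).

Lemma nt_comp_nat F G H (t : nat_trans G H) (s : nat_trans F G) X Y (x : F Y)
  (f : hom X Y) : t X (s X (act x f)) = act (t Y (s Y x)) f.
Proof. by rewrite !nt_nat. Qed.

Definition nt_comp F G H (t : nat_trans G H) (s : nat_trans F G) : nat_trans F H :=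
  NatTrans (nt := fun X x => t X (s X x)) (nt_comp_nat t s).

Definition presheaf_cat : category.
Proof.
refine (@Category presheaf nat_trans nt_id nt_comp _ _ _);
  by move=> *; apply: nat_trans_eq.
Defined.

Section Subpresheaf.
Variables (F : presheaf) (S : forall X, F X -> Prop).
Hypothesis S_act : forall X Y (x : F Y) (f : hom X Y), S x -> S (act x f).

Definition subpresheaf : presheaf.
Proof.
refine (@Presheaf (fun X => {x : F X | S x})
  (fun X Y x f => exist _ (act (sval x) f) (S_act f (svalP x))) _ _).
- move=> X [x Sx]; apply: eq_sig_hprop => [*|/=]; first exact: proof_irrelevance.
  exact: act1.
- move=> X Y Z [x Sx] g f; apply: eq_sig_hprop => [*|/=]; first exact: proof_irrelevance.
  exact: actM.
Defined.

Definition subpresheaf_incl : nat_trans subpresheaf F :=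
  @NatTrans subpresheaf F (fun X x => sval x) (fun X Y x f => erefl).
End Subpresheaf.

End CategoryTheory.

(** * Graphs *)

Record graph := Graph {
  vertex :> Type;
  adj : vertex -> vertex -> Prop;
  adj_sym : forall v w, adj v w -> adj w v;
  adj_irrefl : forall v, ~ adj v v }.

Arguments adj {g} v w.

(** The relation [v ~ w] of the literature. *)
Definition near (G : graph) (v w : G) := v = w \/ adj v w.

Record gmap (G H : graph) := Gmap {
  gfun :> G -> H;
  gfunP : forall v w, near v w -> near (gfun v) (gfun w) }.

Lemma gmap_eq G H (f g : gmap G H) : (forall v, f v = g v) -> f = g.
Proof.
case: f g => [f fP] [g gP] /= /functional_extensionality e.
by case: g / e gP => gP; rewrite (proof_irrelevance _ fP gP).
Qed.

Definition gmap_id G : gmap G G := @Gmap G G id (fun v w h => h).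
Definition gmap_comp G H K (g : gmap H K) (f : gmap G H) : gmap G K :=
  @Gmap G K (fun v => g (f v)) (fun v w h => gfunP g (gfunP f h)).

Definition graph_cat : category.
Proof.
by refine (@Category graph gmap gmap_id gmap_comp _ _ _) => *; apply: gmap_eq.
Defined.

Lemma near_refl (G : graph) (v : G) : near v v. Proof. by left. Qed.
Lemma near_sym (G : graph) (v w : G) : near v w -> near w v.
Proof. by case=> [->|/adj_sym h]; [left|right]. Qed.
#[global] Hint Resolve near_refl : core.

Definition prod_graph (G H : graph) : graph.
Proof.
refine (@Graph (G * H)%type (fun p q =>
  (p.1 = q.1 /\ adj p.2 q.2) \/ (p.2 = q.2 /\ adj p.1 q.1)) _ _).
- by move=> p q [] [-> /adj_sym]; [left|right].
- by move=> p [] [_ /adj_irrefl].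
Defined.

Lemma near_prod (G H : graph) (p q : prod_graph G H) :
  near p q <-> (p.1 = q.1 /\ near p.2 q.2) \/ (p.2 = q.2 /\ near p.1 q.1).
Proof.
case: p q => [a b] [c d]; split => /=.
- by case=> [[-> ->]|[] /= [-> h]]; [left | left; split=> //; right | right; split=> //; right].
- by case=> [] [-> [->|h]]; [left | right; left | left | right; right].
Qed.

(** The power [G^{(x) n}]: its vertices are the n-tuples of vertices, and an
    edge moves exactly one coordinate along an edge of [G]. *)
Definition pow_graph (G : graph) (n : nat) : graph.
Proof.
refine (@Graph ('I_n -> G) (fun x y =>
  exists2 i, adj (x i) (y i) & forall j, j != i -> x j = y j) _ _).
- by move=> x y [i /adj_sym h e]; exists i => // j /e.
- by move=> x [i /adj_irrefl].
Defined.

Lemma pow_graph0 (G : graph) (x y : pow_graph G 0) : x = y.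
Proof. by apply: functional_extensionality => -[]. Qed.

Lemma near_pow (G : graph) n (x y : pow_graph G n) :
  near x y <-> x = y \/ exists2 i, near (x i) (y i) & forall j, j != i -> x j = y j.
Proof.
split=> [[->|[i h e]]|[->|[i [h|h] e]]]; [by left | | by left | left | by right; exists i].
  by right; exists i => //; right.
by apply: functional_extensionality => j; have [->|/e] := eqVneq j i.
Qed.

(** [G^{(x) n+1}] is [G^{(x) n} (x) G]. *)
Definition pow_snoc (G : graph) n (p : prod_graph (pow_graph G n) G) :
  pow_graph G n.+1 := fun j => if unlift ord_max j is Some k then p.1 k else p.2.

Lemma pow_snoc_bij (G : graph) n : bijective (@pow_snoc G n).
Proof.
exists (fun x : 'I_n.+1 -> G => (fun k => x (lift ord_max k), x ord_max)).
- move=> [x t]; rewrite /pow_snoc unlift_none; congr pair.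
  by apply: functional_extensionality => k; rewrite liftK.
- move=> x; apply: functional_extensionality => j; rewrite /pow_snoc.
  by case: unliftP => [k|] ->.
Qed.

Lemma pow_snoc_near (G : graph) n (p q : prod_graph (pow_graph G n) G) :
  near (pow_snoc p) (pow_snoc q) <-> near p q.
Proof.
case: p q => [x s] [y t]; rewrite near_prod near_pow /=.
have E (z : prod_graph (pow_graph G n) G) k : pow_snoc z (lift ord_max k) = z.1 k.
  by rewrite /pow_snoc liftK.
have E' (z : prod_graph (pow_graph G n) G) : pow_snoc z ord_max = z.2.
  by rewrite /pow_snoc unlift_none.
split.
- case=> [e|[i]].
    left; split.
      by apply: functional_extensionality => k; have := congr1 (@^~ (lift ord_max k)) e; rewrite /= !E.
    by have := congr1 (@^~ ord_max) e; rewrite /= !E' => /= ->.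
  case: (unliftP ord_max i) => [k|] ->.
  + rewrite !E /= => h e; right; split.
      by have := e ord_max (neq_lift _ _); rewrite !E'.
    apply/near_pow; right; exists k => // j jk.
    by have := e (lift ord_max j); rewrite !E /=; apply; rewrite (inj_eq lift_inj).
  + rewrite !E' /= => h e; left; split=> //.
    apply: functional_extensionality => j.
    by have := e (lift ord_max j); rewrite !E /=; apply; rewrite eq_sym neq_lift.
- case=> /= [[-> h]|[-> /near_pow [->|[i h e]]]]; [right; exists ord_max | by left | right; exists (lift ord_max i)].
  + by rewrite !E'.
  + by move=> j; case: (unliftP ord_max j) => [k|] -> //; rewrite ?E ?eqxx.
  + by rewrite !E.
  + move=> j; case: (unliftP ord_max j) => [k|] ->; last by rewrite !E'.
    by rewrite !E (inj_eq lift_inj) => /e.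
Qed.

Definition Iinf : graph.
Proof.
refine (@Graph int (fun i j => j = i + 1 \/ i = j + 1) _ _); first tauto.
by move=> i; lia.
Defined.

Definition Ifin (m : nat) : graph.
Proof.
refine (@Graph 'I_m.+1 (fun i j => j = i.+1 :> nat \/ i = j.+1 :> nat) _ _); first tauto.
by move=> i; lia.
Defined.

Notation Icube n := (pow_graph Iinf n).

(** * A-groups *)

Section Quotient.
Variables (T : Type) (R : T -> T -> Prop).

Definition quot := {c : T -> Prop | exists x, c = R x}.
Definition cls (x : T) : quot := exist _ (R x) (ex_intro _ x erefl).
Definition repr (c : quot) : T :=
  sval (constructive_indefinite_description _ (svalP c)).

Lemma reprK : cancel repr cls.
Proof.
move=> c; apply: eq_sig_hprop => [*|/=]; first exact: proof_irrelevance.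
by rewrite /repr; case: constructive_indefinite_description.
Qed.

Hypothesis Rrefl : forall x, R x x.
Hypothesis Rsym : forall x y, R x y -> R y x.
Hypothesis Rtrans : forall x y z, R x y -> R y z -> R x z.

Lemma clsP x y : cls x = cls y <-> R x y.
Proof.
split=> [/(congr1 (fun c : quot => sval c y)) /= ->//|h].
apply: eq_sig_hprop => [*|/=]; first exact: proof_irrelevance.
apply: functional_extensionality => z; apply: propositional_extensionality.
by split; apply: Rtrans => //; apply: Rsym.
Qed.
End Quotient.

Section AGroups.
Variables (n : nat) (G : graph).
Implicit Types (x y : 'I_n -> int) (v : G).

(** The vertices of [I^{(x) n}_{>= M}]. *)
Definition far (M : nat) x := exists i, (M <= absz (x i))%N.

Definition const_far (M : nat) v (f : ('I_n -> int) -> G) :=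
  forall x, far M x -> f x = v.

Record bmap v := Bmap {
  bfun :> gmap (Icube n) G;
  bfunP : exists M, const_far M v bfun }.

Definition homotopic v (f g : bmap v) :=
  exists m (eta : gmap (prod_graph (Icube n) (Ifin m)) G),
    [/\ forall x, eta (x, ord0) = f x,
        forall x, eta (x, ord_max) = g x &
        exists K, forall t, const_far K v (fun x => eta (x, t))].

Definition Agroup v := quot (@homotopic v).

Definition Acls v (f : bmap v) : Agroup v := cls (@homotopic v) f.

Definition bound v (f : bmap v) : nat :=
  sval (constructive_indefinite_description _ (bfunP f)).

Lemma boundP v (f : bmap v) : const_far (bound f) v f.
Proof. by rewrite /bound; case: constructive_indefinite_description. Qed.

Arguments boundP [v] f x _.

Definition upd (x : 'I_n -> int) (i : 'I_n) (t : int) : 'I_n -> int :=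
  fun j => if j == i then t else x j.

(** Concatenation in direction [i]: [f], constant for [|x_i| >= M], is followed
    by a translate of [g], constant for [|x_i| >= N]. *)
Definition concat_fun (i : 'I_n) (M N : nat) (f g : ('I_n -> int) -> G) x :=
  if x i <= M%:Z then f x else g (upd x i (x i - (M + N)%:Z)).

Lemma const_farW M N v f : (M <= N)%N -> const_far M v f -> const_far N v f.
Proof. by move=> h c x [i hi]; apply: c; exists i; apply: leq_trans hi. Qed.

Lemma concat_near i M N v (f g : gmap (Icube n) G) :
  const_far M v f -> const_far N v g ->
  forall x y, near (x : Icube n) y ->
    near (concat_fun i M N f g x) (concat_fun i M N f g y).
Proof.
move=> cf cg.
have key x y : near (x : Icube n) y -> x i <= M%:Z -> M%:Z < y i ->
    near (f x) (g (upd y i (y i - (M + N)%:Z))).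
  move=> /near_pow [->|[k h e] h1 h2]; first by move=> *; lia.
  have ki : i = k by apply/eqP; apply: contraT => /e; lia.
  subst k; case: h => /= h; first lia.
  rewrite cf; last by exists i; lia.
  rewrite -(cg (upd y i (- N%:Z))); last by exists i; rewrite /upd eqxx; lia.
  apply: gfunP; apply/near_pow; right; exists i; last by move=> j /negPf ji; rewrite /upd ji.
  by rewrite /upd eqxx; right; left; lia.
move=> x y nxy; rewrite /concat_fun.
case: (leP (x i) M%:Z) => hx; case: (leP (y i) M%:Z) => hy.
- exact: gfunP.
- exact: key.
- by apply: near_sym; apply: key => //; apply: near_sym.
- apply: gfunP; case/near_pow: nxy => [->|[k h e]] //.
  apply/near_pow; right; exists k; rewrite /upd.
    case: eqP => [E|//]; subst k; case: h => /= h; first by left; rewrite h.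
    by right; case: h => h; [left|right] => /=; lia.
  by move=> j /e E; case: eqP => [ji|//]; rewrite -ji E.
Qed.

Lemma concat_far i M N v f g : const_far M v f -> const_far N v g ->
  const_far (M + N + N) v (concat_fun i M N f g).
Proof.
move=> cf cg x [j hj]; rewrite /concat_fun; case: leP => hi.
  by apply: cf; exists j; lia.
apply: cg; exists j; rewrite /upd; case: eqP => [E|_]; last lia.
by subst j; lia.
Qed.

Definition concat_bmap i M N v (f g : bmap v)
    (cf : const_far M v f) (cg : const_far N v g) : bmap v :=
  @Bmap v (Gmap (gfun := concat_fun i M N f g : Icube n -> G) (concat_near i cf cg))
    (ex_intro (fun K => const_far K v (concat_fun i M N f g)) _ (concat_far i cf cg)).

Definition concat i v (f g : bmap v) : bmap v :=
  concat_bmap i (boundP f) (boundP g).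

(** The group law of [A_n(G,v)] for [n >= 1]; it does not depend on the chosen
    representatives and bounds, see [Amul_cls]. *)
Definition Amul (i : 'I_n) v (a b : Agroup v) : Agroup v :=
  Acls (concat i (repr a) (repr b)).

Lemma prod_near (A B K : graph) (h : A * B -> K) :
  (forall a a' b, near a a' -> near (h (a, b)) (h (a', b))) ->
  (forall a b b', near b b' -> near (h (a, b)) (h (a, b'))) ->
  forall p q : prod_graph A B, near p q -> near (h p) (h q).
Proof.
move=> hA hB [a b] [a' b'] /near_prod /= [[<-]|[<-]]; [exact: hB|exact: hA].
Qed.

Lemma gmap_prodl (A B K : graph) (h : gmap (prod_graph A B) K) b a a' :
  near a a' -> near (h (a, b)) (h (a', b)).
Proof. by move=> aa'; apply: gfunP; apply/near_prod; right. Qed.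

Lemma gmap_prodr (A B K : graph) (h : gmap (prod_graph A B) K) a b b' :
  near b b' -> near (h (a, b)) (h (a, b')).
Proof. by move=> bb'; apply: gfunP; apply/near_prod; left. Qed.

Lemma Ifin_near m (s t : Ifin m) :
  near s t <-> [\/ s = t :> nat, t = s.+1 :> nat | s = t.+1 :> nat].
Proof.
split=> [[->|[]]|[/val_inj->|h|h]]; first [by constructor | by left | by right; [left + right] | idtac].
all: by right; tauto.
Qed.

Lemma homotopic_ext v (f g : bmap v) : f =1 g -> homotopic f g.
Proof.
move=> fg; have hP : forall p q : prod_graph (Icube n) (Ifin 0), near p q -> near (f p.1) (f q.1).
  by apply: prod_near => //= a a' b; apply: gfunP.
exists 0%N, (Gmap (gfun := fun p : prod_graph (Icube n) (Ifin 0) => f p.1) hP).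
by split=> //; exists (bound f) => t; apply: boundP.
Qed.

Lemma homotopic_refl v (f : bmap v) : homotopic f f.
Proof. exact: homotopic_ext. Qed.

Lemma homotopic_sym v (f g : bmap v) : homotopic f g -> homotopic g f.
Proof.
case=> m [eta [e0 e1 [K cK]]].
pose h (p : prod_graph (Icube n) (Ifin m)) : G := eta (p.1, rev_ord p.2).
have hP : forall p q, near p q -> near (h p) (h q).
  apply: prod_near => [a a' b|a b b'] /=; first exact: gmap_prodl.
  move=> /Ifin_near bb'; apply: gmap_prodr; apply/Ifin_near => /=.
  have := ltn_ord b; have := ltn_ord b'; rewrite !subSS.
  by case: bb' => E; [constructor 1|constructor 3|constructor 2]; lia.
exists m, (Gmap hP); split=> [x|x|]; rewrite /= /h /=.
- by rewrite -e1; congr (eta (_, _)); apply: val_inj => /=; rewrite subn1.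
- by rewrite -e0; congr (eta (_, _)); apply: val_inj => /=; rewrite subnn.
- by exists K => t x; apply: cK.
Qed.

Lemma homotopic_trans v (f g h : bmap v) :
  homotopic f g -> homotopic g h -> homotopic f h.
Proof.
case=> m [eta [e0 e1 [K cK]]] [m' [eta' [e0' e1' [K' cK']]]].
pose F (p : prod_graph (Icube n) (Ifin (m + m'))) : G :=
  if (p.2 <= m)%N then eta (p.1, inord p.2) else eta' (p.1, inord (p.2 - m)).
have key a (b b' : 'I_(m + m').+1) : b' = b.+1 :> nat -> near (F (a, b)) (F (a, b')).
  move=> E; rewrite /F /=; have lb := ltn_ord b; have lb' := ltn_ord b'.
  case: (leqP b m) => hb; case: (leqP b' m) => hb'.
  - apply: gmap_prodr; apply/Ifin_near; rewrite !inordK; try lia.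
    by constructor 2.
  - have -> : eta (a, inord b) = eta' (a, ord0).
      by rewrite e0' -e1; congr (eta (_, _)); apply: val_inj; rewrite /= inordK; lia.
    apply: gmap_prodr; apply/Ifin_near; rewrite !inordK /=; try lia.
    by constructor 2; lia.
  - lia.
  - apply: gmap_prodr; apply/Ifin_near; rewrite !inordK; try lia.
    by constructor 2; lia.
have FP : forall p q, near p q -> near (F p) (F q).
  apply: prod_near => [a a' b aa'|a b b'].
    by rewrite /F /=; case: ifP => _; apply: gmap_prodl.
  case/Ifin_near => [/val_inj->|/key//|/key /near_sym]; [exact: near_refl|exact].
exists (m + m')%N, (Gmap FP); split=> [x|x|]; rewrite /= /F /=.
- by rewrite -e0; congr (eta (_, _)); apply: val_inj; rewrite /= inordK.
- case: leqP => hm.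
    have Em : m' = 0%N by lia.
    subst m'; rewrite -e1' (_ : ord_max = ord0) ?e0' -?e1; last exact: val_inj.
    by congr (eta (_, _)); apply: val_inj; rewrite /= inordK; lia.
  by rewrite -e1'; congr (eta' (_, _)); apply: val_inj; rewrite /= inordK; lia.
- exists (K + K')%N => t x hx; case: ifP => _.
    by apply: cK; case: hx => i hi; exists i; lia.
  by apply: cK'; case: hx => i hi; exists i; lia.
Qed.

Lemma AclsP v (f g : bmap v) : Acls f = Acls g <-> homotopic f g.
Proof.
apply: clsP; [exact: homotopic_refl|exact: homotopic_sym|exact: homotopic_trans].
Qed.

Lemma homotopic_step v (f g : bmap v) : (forall x, near (f x) (g x)) -> homotopic f g.
Proof.
move=> fg; pose h (p : prod_graph (Icube n) (Ifin 1)) : G :=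
  if p.2 == ord0 then f p.1 else g p.1.
have hP : forall p q, near p q -> near (h p) (h q).
  apply: prod_near => [a a' b aa'|a b b' _]; rewrite /h /=.
    by case: ifP => _; apply: gfunP.
  by case: ifP => _; case: ifP => _ //; apply: near_sym.
exists 1%N, (Gmap hP); split=> //.
exists (bound f + bound g)%N => t x [i hi]; rewrite /= /h /=; case: ifP => _.
  by apply: boundP; exists i; lia.
by apply: boundP; exists i; lia.
Qed.

Lemma concat_shift1 i M N v (f g : bmap v) (cf : const_far M v f)
    (cf' : const_far M.+1 v f) (cg : const_far N v g) :
  homotopic (concat_bmap i cf cg) (concat_bmap i cf' cg).
Proof.
apply: homotopic_step => x; rewrite /= /concat_fun.
have key : near (g (upd x i (x i - (M + N)%:Z))) (g (upd x i (x i - (M.+1 + N)%:Z))).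
  apply: gfunP; apply/near_pow; right; exists i; last by move=> j /negPf ji; rewrite /upd ji.
  by rewrite /upd eqxx; right; right => /=; lia.
case: (leP (x i) M%:Z) => h1; case: (leP (x i) M.+1%:Z) => h2 //; first lia.
suff -> : f x = g (upd x i (x i - (M.+1 + N)%:Z)) by [].
rewrite (cf x); last by exists i; lia.
by rewrite cg //; exists i; rewrite /upd eqxx; lia.
Qed.

Lemma concat_shift i M N k v (f g : bmap v) (cf : const_far M v f)
    (cf' : const_far (M + k) v f) (cg : const_far N v g) :
  homotopic (concat_bmap i cf cg) (concat_bmap i cf' cg).
Proof.
elim: k cf' => [|k IH] cf'; first by apply: homotopic_ext => x /=; rewrite addn0.
have cfk : const_far (M + k) v f by apply: const_farW (cf); lia.
apply: homotopic_trans (IH cfk) _; move: cf'; rewrite addnS => cf'.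
exact: concat_shift1.
Qed.

Lemma concat_swap i M N k v (f g : bmap v) : const_far M v f -> const_far N v g ->
  concat_fun i (M + k) N f g =1 concat_fun i M (N + k) f g.
Proof.
move=> cf cg x; rewrite /concat_fun.
case: (leP (x i) M%:Z) => h1; case: (leP (x i) (M + k)%:Z) => h2; try lia; try by [].
- rewrite cf; last by exists i; lia.
  by rewrite cg //; exists i; rewrite /upd eqxx; lia.
- by rewrite addnAC addnA.
Qed.

Lemma concat_bound i M N M' N' v (f g : bmap v)
    (cf : const_far M v f) (cf' : const_far M' v f)
    (cg : const_far N v g) (cg' : const_far N' v g) :
  (M <= M')%N -> (N <= N')%N ->
  homotopic (concat_bmap i cf cg) (concat_bmap i cf' cg').
Proof.
move=> hM hN; have cf2 : const_far (M' + (N' - N)) v f by apply: const_farW (cf); lia.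
have cfM : const_far (M + (M' - M)) v f by apply: const_farW (cf); lia.
apply: homotopic_trans (concat_shift i cf cfM cg) _.
apply: (@homotopic_trans _ _ (concat_bmap i cf' cg)).
  by apply: homotopic_ext => x /=; rewrite subnKC.
apply: homotopic_trans (concat_shift i cf' cf2 cg) _.
apply: homotopic_ext => x /=; rewrite concat_swap //.
by rewrite subnKC.
Qed.

Lemma concat_homotopicl i v (f f' g : bmap v) : homotopic f f' ->
  exists K, forall L (cf : const_far L v f) (cf' : const_far L v f')
    (cg : const_far L v g), (K <= L)%N ->
  homotopic (concat_bmap i cf cg) (concat_bmap i cf' cg).
Proof.
case=> m [eta [e0 e1 [K cK]]]; exists K => L cf cf' cg KL.
pose h (p : prod_graph (Icube n) (Ifin m)) : G :=
  concat_fun i L L (fun x => eta (x, p.2)) g p.1.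
have cL t : const_far L v (fun x => eta (x, t)) by apply: const_farW (cK t).
have hP : forall p q, near p q -> near (h p) (h q).
  apply: prod_near => [a a' b|a b b' bb'].
    exact: (@concat_near i L L v (Gmap (gfun := fun x : Icube n => eta (x, b))
      (@gmap_prodl _ _ _ eta b)) g (cL b) cg).
  by rewrite /h /concat_fun /=; case: leP => // _; apply: gmap_prodr.
exists m, (Gmap hP); split=> [x|x|].
- by rewrite /= /h /concat_fun /= e0.
- by rewrite /= /h /concat_fun /= e1.
- by exists (L + L + L)%N => t; apply: (concat_far i (cL t) cg).
Qed.

Lemma concat_homotopicr i v (f g g' : bmap v) : homotopic g g' ->
  exists K, forall L (cf : const_far L v f) (cg : const_far L v g)
    (cg' : const_far L v g'), (K <= L)%N ->
  homotopic (concat_bmap i cf cg) (concat_bmap i cf cg').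
Proof.
case=> m [eta [e0 e1 [K cK]]]; exists K => L cf cg cg' KL.
pose h (p : prod_graph (Icube n) (Ifin m)) : G :=
  concat_fun i L L f (fun x => eta (x, p.2)) p.1.
have cL t : const_far L v (fun x => eta (x, t)) by apply: const_farW (cK t).
have hP : forall p q, near p q -> near (h p) (h q).
  apply: prod_near => [a a' b|a b b' bb'].
    exact: (@concat_near i L L v f (Gmap (gfun := fun x : Icube n => eta (x, b))
      (@gmap_prodl _ _ _ eta b)) cf (cL b)).
  by rewrite /h /concat_fun /=; case: leP => // _; apply: gmap_prodr.
exists m, (Gmap hP); split=> [x|x|].
- by rewrite /= /h /concat_fun /= e0.
- by rewrite /= /h /concat_fun /= e1.
- by exists (L + L + L)%N => t; apply: (concat_far i cf (cL t)).
Qed.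

Lemma repr_homotopic v (f : bmap v) : homotopic (repr (Acls f)) f.
Proof. by apply/AclsP; apply: reprK. Qed.

Lemma Amul_cls i M N v (f g h : bmap v) : const_far M v f -> const_far N v g ->
  h =1 concat_fun i M N f g -> Amul i (Acls f) (Acls g) = Acls h.
Proof.
move=> cf cg hE; apply/AclsP; set f' := repr _; set g' := repr _.
have hf : homotopic f' f := repr_homotopic f.
have hg : homotopic g' g := repr_homotopic g.
have [K1 H1] := concat_homotopicl i g' hf; have [K2 H2] := concat_homotopicr i f hg.
pose L := (K1 + K2 + M + N + bound f' + bound g')%N.
have cf1 : const_far L v f' by apply: const_farW (boundP f'); rewrite /L; lia.
have cg1 : const_far L v g' by apply: const_farW (boundP g'); rewrite /L; lia.
have cf2 : const_far L v f by apply: const_farW (cf); rewrite /L; lia.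
have cg2 : const_far L v g by apply: const_farW (cg); rewrite /L; lia.
apply: (@homotopic_trans _ _ (concat_bmap i cf1 cg1)).
  by apply: concat_bound; rewrite /L; lia.
apply: (@homotopic_trans _ _ (concat_bmap i cf2 cg1)); first by apply: H1; rewrite /L; lia.
apply: (@homotopic_trans _ _ (concat_bmap i cf2 cg2)); first by apply: H2; rewrite /L; lia.
apply: (@homotopic_trans _ _ (concat_bmap i cf cg)).
  by apply: homotopic_sym; apply: concat_bound; rewrite /L; lia.
by apply: homotopic_ext => x; rewrite hE.
Qed.

End AGroups.

Section AMap.
Variables (n : nat) (G H : graph) (phi : gmap G H) (v : G).

Lemma postcomp_far (f : bmap n v) :
  exists M, const_far M (phi v) (gmap_comp phi f).
Proof. by exists (bound f) => x /boundP /= ->. Qed.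

Definition postcomp (f : bmap n v) : bmap n (phi v) := Bmap (postcomp_far f).

(** The map induced by postcomposition, see [Amap_cls]. *)
Definition Amap (a : Agroup n v) : Agroup n (phi v) := Acls (postcomp (repr a)).

Lemma Amap_cls (f : bmap n v) : Amap (Acls f) = Acls (postcomp f).
Proof.
apply/AclsP; case: (repr_homotopic f) => m [eta [e0 e1 [K cK]]].
exists m, (gmap_comp phi eta); split=> [x|x|] /=.
- by rewrite e0.
- by rewrite e1.
- by exists K => t x /cK /= ->.
Qed.

(** For [n = 0] the second clause is void and this is just a bijection. *)
Definition Amap_iso :=
  bijective Amap /\
  forall (i : 'I_n) (a b : Agroup n v), Amap (Amul i a b) = Amul i (Amap a) (Amap b).

End AMap.

(** For non-empty [G] the second clause follows from the first.  For empty [G]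
    the first one is void, whereas [A_0], the set of connected components, makes
    sense without a base vertex; the second clause says that it is preserved.
    Without it, every map out of the empty graph would be a weak equivalence and
    two-out-of-three would fail. *)
Definition weak_homotopy_equiv : mclass graph_cat := fun G H f =>
  (forall (v : G) (n : nat), Amap_iso n f v) /\ (inhabited H -> inhabited G).

(** * The box category *)

(** Formal composites of generators of the box category; [Wconn i false] and
    [Wconn i true] are the max and min connections. *)
Inductive word : nat -> nat -> Type :=
| Wid n : word n n
| Wface n (i : 'I_n.+1) (e : bool) : word n n.+1
| Wdegen n (i : 'I_n.+1) : word n.+1 n
| Wconn n (i : 'I_n.+1) (e : bool) : word n.+2 n.+1
| Wcomp m n p : word n p -> word m n -> word m p.

Section WordEval.
Variables (T : Type) (c : bool -> T) (op : bool -> T -> T -> T).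

Definition insert n (i : 'I_n.+1) (t : T) (x : 'I_n -> T) : 'I_n.+1 -> T :=
  fun j => if unlift i j is Some k then x k else t.

Definition delete n (i : 'I_n.+1) (x : 'I_n.+1 -> T) : 'I_n -> T :=
  fun j => x (lift i j).

Definition merge n (i : 'I_n.+1) (o : T -> T -> T) (x : 'I_n.+2 -> T) : 'I_n.+1 -> T :=
  fun j => if (j < i)%N then x (widen_ord (leqnSn _) j)
           else if j == i then o (x (widen_ord (leqnSn _) i)) (x (lift ord0 i))
           else x (lift ord0 j).

(** The action of a word on tuples with entries in any type with two endpoints
    [c] and two binary operations [op]. *)
Fixpoint weval m n (w : word m n) : ('I_m -> T) -> ('I_n -> T) :=
  match w with
  | Wid _ => fun x => x
  | Wface _ i e => insert i (c e)
  | Wdegen _ i => delete i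
  | Wconn _ i e => merge i (op e)
  | Wcomp _ _ _ w' w => fun x => weval w' (weval w x)
  end.
End WordEval.

Lemma weval_morph T T' (c : bool -> T) op (c' : bool -> T') op' (h : T -> T') :
  (forall e, h (c e) = c' e) -> (forall e s t, h (op e s t) = op' e (h s) (h t)) ->
  forall m n (w : word m n) x,
    h \o weval c op w x = weval c' op' w (h \o x).
Proof.
move=> hc hop m n w; elim: w => {m n} [n|n i e|n i|n i e|m n p w1 IH1 w2 IH2] x //=.
- apply: functional_extensionality => j; rewrite /insert /=.
  by case: unlift.
- apply: functional_extensionality => j; rewrite /merge /=.
  by case: ifP => // _; case: eqP.
- by rewrite IH1 IH2.
Qed.

Definition bool_op (e : bool) : bool -> bool -> bool := if e then andb else orb.
Definition word_bool m n (w : word m n) := weval id bool_op w.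

(** The morphisms [[1]^m -> [1]^n] are the maps generated by faces, degeneracies
    and connections; they are automatically monotone. *)
Definition box_hom (m n : nat) :=
  {phi : ('I_m -> bool) -> ('I_n -> bool) | exists w : word m n, phi = word_bool w}.

Lemma box_hom_eq m n (phi psi : box_hom m n) : sval phi = sval psi -> phi = psi.
Proof. by move=> e; apply: eq_sig_hprop => // *; apply: proof_irrelevance. Qed.

Definition box_gen m n (w : word m n) : box_hom m n :=
  exist _ (word_bool w) (ex_intro _ w erefl).

Lemma box_comp_word m n p (psi : box_hom n p) (phi : box_hom m n) :
  exists w : word m p, (fun x => sval psi (sval phi x)) = word_bool w.
Proof.
by have [w1 E1] := svalP psi; have [w2 E2] := svalP phi; exists (Wcomp w1 w2); rewrite E1 E2.
Qed.

Definition box_comp m n p (psi : box_hom n p) (phi : box_hom m n) : box_hom m p :=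
  exist _ _ (box_comp_word psi phi).

Definition box_cat : category.
Proof.
by refine (@Category nat box_hom (fun n => box_gen (Wid n)) box_comp _ _ _) => *;
  apply: box_hom_eq.
Defined.

Definition face n (i : 'I_n.+1) (e : bool) : box_hom n n.+1 := box_gen (Wface i e).
Definition degen n (i : 'I_n.+1) : box_hom n.+1 n := box_gen (Wdegen i).
Definition conn n (i : 'I_n.+1) (e : bool) : box_hom n.+2 n.+1 := box_gen (Wconn i e).

(** * Cubical sets *)

Definition cset := presheaf box_cat.
Definition cset_cat := presheaf_cat box_cat.

(** The presheaf represented by [[1]^n]. *)
Definition cube (n : nat) : cset :=
  @Presheaf box_cat (fun m => box_hom m n) (fun m m' f g => box_comp f g)
    (fun m f => @compm1 box_cat m n f) (fun m m' m'' f g h => @compA box_cat _ _ _ _ f g h).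

Definition in_open_box n (i : 'I_n.+1) (e : bool) (m : box_cat) (phi : cube n.+1 m) :=
  exists j d, (j, d) <> (i, e) /\ exists psi : box_hom m n, phi = box_comp (face j d) psi.

Lemma in_open_box_act n (i : 'I_n.+1) (e : bool) (m m' : box_cat)
    (phi : cube n.+1 m') (f : hom m m') :
  in_open_box i e phi -> in_open_box i e (act phi f).
Proof.
move=> [j [d [ne [psi ->]]]]; exists j, d; split=> //; exists (box_comp psi f).
exact: box_hom_eq.
Qed.

Definition open_box n (i : 'I_n.+1) (e : bool) : cset :=
  subpresheaf (@in_open_box_act n i e).

Definition open_box_incl n (i : 'I_n.+1) (e : bool) :
    @hom cset_cat (open_box i e) (cube n.+1) :=
  subpresheaf_incl (@in_open_box_act n i e).

Definition kan_fibration : mclass cset_cat := fun X Y p =>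
  forall n (i : 'I_n.+1) (e : bool), rlp (open_box_incl i e) p.

(** * The nerve *)

Definition int_end (M : nat) (e : bool) : int := if e then M%:Z else - M%:Z.
Definition int_op (e : bool) : int -> int -> int := if e then Num.min else Num.max.
Definition word_int (M : nat) m n (w : word m n) := weval (int_end M) int_op w.

Definition stable n (G : graph) (M : nat) (f : ('I_n -> int) -> G) :=
  forall (i : 'I_n) x,
    (M%:Z < x i -> f x = f (upd x i M%:Z)) /\
    (x i < - M%:Z -> f x = f (upd x i (- M%:Z))).

Definition clamp (M : nat) (t : int) : int := Num.max (- M%:Z) (Num.min t M%:Z).

Lemma stable_clamp n (G : graph) M (f : ('I_n -> int) -> G) :
  stable M f <-> forall x, f (clamp M \o x) = f x.
Proof.
split=> [sf x|cf i x].
  have step (s : seq 'I_n) : f x = f (fun j => if j \in s then clamp M (x j) else x j).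
    elim: s => [|i s IH]; first by congr f.
    rewrite IH; set y := (fun j : 'I_n => _); set z := (fun j : 'I_n => _).
    have zE : z = upd y i (clamp M (x i)).
      apply: functional_extensionality => j; rewrite /z /y /upd inE.
      by case: eqP => [->|].
    have yi : y i = clamp M (x i) \/ y i = x i by rewrite /y; case: ifP; tauto.
    rewrite zE; case: yi => yi.
      by congr f; apply: functional_extensionality => j; rewrite /upd; case: eqP => [->|].
    have [h1 h2] := sf i y; rewrite /clamp -yi.
    case: (ltP M%:Z (y i)) => a; first by rewrite h1 //; congr (f (upd _ _ _)); lia.
    case: (ltP (y i) (- M%:Z)) => b; first by rewrite h2 //; congr (f (upd _ _ _)); lia.
    congr f; apply: functional_extensionality => j; rewrite /upd; case: eqP => [->|//]; lia.
  rewrite (step (enum 'I_n)); congr f; apply: functional_extensionality => j.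
  by rewrite mem_enum.
split=> h; rewrite -(cf x) -(cf (upd _ _ _)); congr f.
all: apply: functional_extensionality => j; rewrite /= /upd; case: eqP => [->|//].
all: rewrite /clamp; lia.
Qed.

Lemma word_int_clamp M M' m n (w : word m n) x : (M <= M')%N ->
  clamp M \o word_int M' w x = word_int M w (clamp M \o x).
Proof.
by move=> h; apply: weval_morph => [[]|[] s t]; rewrite /clamp /int_end /int_op; lia.
Qed.

Lemma stable_word n (G : graph) M (f : ('I_n -> int) -> G) m (w : word m n) :
  stable M f -> stable M (f \o word_int M w).
Proof.
move=> /stable_clamp sf; apply/stable_clamp => x.
by rewrite /= -[in RHS]sf word_int_clamp.
Qed.

Lemma word_int_bound n (G : graph) M M' (f : ('I_n -> int) -> G) m (w : word m n) x :
  stable M f -> stable M' f -> f (word_int M w x) = f (word_int M' w x).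
Proof.
wlog h : M M' / (M <= M')%N => [hw sM sM'|/stable_clamp sf _].
  by case/orP: (leq_total M M') => h; [|symmetry]; apply: hw.
by rewrite -[LHS]sf -[RHS]sf !word_int_clamp.
Qed.

Lemma word_threshold M m n (w : word m n) x (t : int) : - M%:Z < t <= M%:Z ->
  (fun s => t <= s) \o word_int M w x = word_bool w ((fun s => t <= s) \o x).
Proof.
by move=> ht; apply: weval_morph => [[]|[] s s'];
  rewrite /int_end /int_op /bool_op; lia.
Qed.

Lemma word_int_ext n (G : graph) M (f : ('I_n -> int) -> G) m (w w' : word m n) x :
  stable M f -> word_bool w = word_bool w' -> f (word_int M w x) = f (word_int M w' x).
Proof.
move=> /stable_clamp sf ww'; rewrite -[LHS]sf -[RHS]sf; congr f.
apply: functional_extensionality => j /=.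
have H t : - M%:Z < t <= M%:Z -> (t <= word_int M w x j) = (t <= word_int M w' x j).
  move=> ht; have := word_threshold w x ht; rewrite ww' -(word_threshold w' x ht).
  by move/(congr1 (@^~ j)).
set a := word_int M w x j in H *; set b := word_int M w' x j in H *.
have := H (clamp M a); have := H (clamp M b); rewrite /clamp; lia.
Qed.

Lemma word_int_near M m n (w : word m n) (x y : Icube m) :
  near x y -> near (word_int M w x : Icube n) (word_int M w y).
Proof.
elim: w x y => {m n} [n|n i e|n i|n i e|m n p w1 IH1 w2 IH2] x y //=.
- move=> /near_pow [->//|[k h E]]; apply/near_pow; right; exists (lift i k).
    by rewrite /word_int /= /insert liftK.
  move=> j; rewrite /word_int /= /insert; case: unliftP => [l|] -> //.
  by rewrite (inj_eq lift_inj) => /E.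
- move=> /near_pow [->//|[k h E]]; apply/near_pow.
  rewrite /word_int /= /delete; case: (unliftP i k) => [l|] kE; last first.
    left; apply: functional_extensionality => j; apply: E.
    by rewrite kE eq_sym neq_lift.
  right; exists l; first by rewrite -kE.
  by move=> j jl; apply: E; rewrite kE (inj_eq lift_inj).
- move=> /near_pow [->//|[k h E]]; apply/near_pow; right.
  have E' (j : 'I_n.+2) : (j != k :> nat) -> x j = y j by move=> jk; apply: E.
  have nmm (s t s' t' : Iinf) : near s t -> near s' t' -> (s = t \/ s' = t') ->
      near (int_op e s s' : Iinf) (int_op e t t').
    rewrite /near /= /int_op; case: (e) => /=; lia.
  have ni (j : 'I_n.+2) : near (x j : Iinf) (y j).
    by have [->|/E->] := eqVneq j k.
  exists (inord (if (k <= i)%N then k : nat else k.-1)).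
    rewrite /word_int /= /merge; case: ifP => _; first exact: ni.
    case: ifP => _; last exact: ni.
    apply: nmm; try exact: ni.
    case: (eqVneq (i : nat) k) => ik; [right|left]; apply: E' => //=.
    by rewrite /bump /= -ik; lia.
  move=> j; rewrite -val_eqE /= inordK; last first.
    by have := ltn_ord k; have := ltn_ord i; case: ifP; lia.
  move=> jk; rewrite /word_int /= /merge.
  case: ifP => ji; first by apply: E' => /=; move: jk; case: ifP; lia.
  case: eqP => [jE|/eqP jE].
    subst j; congr (int_op e _ _); apply: E' => /=; move: jk; rewrite /bump /=; case: ifP; lia.
  apply: E' => /=; move: jk jE; rewrite -val_eqE /= /bump /=; case: ifP; lia.
- by move=> /IH2 /IH1.
Qed.

Record cell (G : graph) (n : nat) := Cell {
  cfun :> gmap (Icube n) G;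
  cfunP : exists M, stable M cfun }.

Lemma cell_eq G n (f g : cell G n) : f =1 g -> f = g.
Proof.
case: f g => [f fP] [g gP] /= fg; have e : f = g by apply: gmap_eq.
by case: g / e gP {fg} => gP; rewrite (proof_irrelevance _ fP gP).
Qed.

Definition sbound G n (f : cell G n) : nat :=
  sval (constructive_indefinite_description _ (cfunP f)).

Lemma sboundP G n (f : cell G n) : stable (sbound f) f.
Proof. by rewrite /sbound; case: constructive_indefinite_description. Qed.
Arguments sboundP [G n] f i x.

Definition word_of m n (phi : box_hom m n) : word m n :=
  sval (constructive_indefinite_description _ (svalP phi)).

Lemma word_ofK m n (phi : box_hom m n) : sval phi = word_bool (word_of phi).
Proof. by rewrite /word_of; case: constructive_indefinite_description. Qed.

(** A box morphism acts through any word [w] representing it and any stability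
    bound, see [nerve_actE]. *)
Definition nerve_act G m n (f : cell G n) (phi : box_hom m n) : cell G m :=
  @Cell G m
    (gmap_comp f (Gmap (gfun := word_int (sbound f) (word_of phi) : Icube m -> Icube n)
      (@word_int_near (sbound f) m n (word_of phi))))
    (ex_intro (fun M => stable M (f \o word_int (sbound f) (word_of phi))) _
      (stable_word (word_of phi) (sboundP f))).

Lemma nerve_actE G m n (f : cell G n) (phi : box_hom m n) M (w : word m n) x :
  stable M f -> sval phi = word_bool w -> nerve_act f phi x = f (word_int M w x).
Proof.
move=> sf; rewrite word_ofK => e /=.
by rewrite (word_int_ext _ (sboundP f) e); apply: word_int_bound => //; apply: (sboundP f).
Qed.

Lemma nerve_act1 G n (f : cell G n) : nerve_act f (box_gen (Wid n)) = f.
Proof. by apply: cell_eq => x; rewrite (nerve_actE (w := Wid n) _ (sboundP f)). Qed.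

Lemma nerve_actM G m n p (f : cell G p) (psi : box_hom n p) (phi : box_hom m n) :
  nerve_act f (box_comp psi phi) = nerve_act (nerve_act f psi) phi.
Proof.
have sf := sboundP f; set M := sbound f in sf.
apply: cell_eq => x.
rewrite (@nerve_actE _ _ _ _ _ M (Wcomp (word_of psi) (word_of phi))) //; last first.
  by rewrite /= !word_ofK.
rewrite (@nerve_actE _ _ _ (nerve_act f psi) phi M (word_of phi)) //; last exact: word_ofK.
exact: stable_word.
Qed.

Definition nerve_obj (G : graph) : cset :=
  @Presheaf box_cat (cell G) (fun m n f phi => nerve_act f phi)
    (@nerve_act1 G) (fun m n p f psi phi => nerve_actM f psi phi).

Section NerveGenerators.
Variables (G : graph) (n : nat).

Lemma nerve_face (f : cell G n.+1) i e M x : stable M f ->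
  nerve_act f (face i e) x = f (insert i (int_end M e) x).
Proof. by move=> sf; rewrite (nerve_actE (w := Wface i e) _ sf). Qed.

Lemma nerve_degen (f : cell G n) i x : nerve_act f (degen i) x = f (delete i x).
Proof. by rewrite (nerve_actE (w := Wdegen i) _ (sboundP f)). Qed.

Lemma nerve_conn (f : cell G n.+1) i e x :
  nerve_act f (conn i e) x = f (merge i (if e then Num.min else Num.max) x).
Proof. by rewrite (nerve_actE (w := Wconn i e) _ (sboundP f)). Qed.
End NerveGenerators.

Section NerveMap.
Variables (G H : graph) (phi : gmap G H).

Lemma nerve_map_stable n (f : cell G n) : exists M, stable M (gmap_comp phi f).
Proof.
exists (sbound f) => i x; have [h1 h2] := sboundP f i x.
by split=> h; apply: (congr1 phi); [exact: h1|exact: h2].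
Qed.

Definition nerve_cell n (f : cell G n) : cell H n := Cell (nerve_map_stable f).

Lemma nerve_cell_nat m n (f : cell G n) (psi : box_hom m n) :
  nerve_cell (nerve_act f psi) = nerve_act (nerve_cell f) psi.
Proof.
apply: cell_eq => x.
have sf : stable (sbound f) (nerve_cell f).
  by move=> i y; have [h1 h2] := sboundP f i y; split=> h; apply: (congr1 phi); [exact: h1|exact: h2].
by rewrite (nerve_actE x sf (word_ofK psi)).
Qed.

Definition nerve_map : nat_trans (nerve_obj G) (nerve_obj H) :=
  @NatTrans box_cat (nerve_obj G) (nerve_obj H) nerve_cell
    (fun m n f psi => nerve_cell_nat f psi).
End NerveMap.

Definition nerve : functor graph_cat cset_cat.
Proof.
refine (@Functor graph_cat cset_cat nerve_obj nerve_map _ _).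
- move=> G; apply: (@nat_trans_eq box_cat) => m f. exact: cell_eq.
- by move=> G H K g f; apply: (@nat_trans_eq box_cat) => m x; apply: cell_eq.
Defined.

Definition nerve_fibration : mclass graph_cat := fun G H f =>
  kan_fibration (fmap nerve f).

(* Main.v *)
From Stdlib Require Import FunctionalExtensionality ProofIrrelevance ClassicalEpsilon.
From mathcomp Require Import all_boot all_order all_algebra.
From mathcomp Require Import zify.
Require Import Defs.

(** The nerve turns graphs into Kan complexes, and everything else follows from
    filling open boxes.

    A morphism of the box category acts on maps [I^n -> G] through words in max,
    min and the constants [+-M], so a map from an open box to a nerve is the
    same as a function on the union of the faces of a large cube, defined up to
    enlarging the cube ([nerve_fibrationP]).  Fibrations thereby become graph
    maps that lift stable maps [I^n -> B] relative to a given lift on all faces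
    but one ([box_lifting]).  For [B] a point such lifts always exist, because
    the cube of size [3M] retracts onto the open box of size [M] by the formula
    [box_retr], which is a graph map and clamps the coordinates on the faces
    ([box_filler]).  So all graphs are fibrant.

    Two-out-of-three needs only a change of base point along a path.  Along an
    edge this amounts to changing the value at infinity ([homotopic_near]), and
    surjectivity on components provides the path.

    Acyclic fibrations [p : E -> B] are stable under pullback by two lifting
    arguments.  A based map to [B] that comes from [E] up to homotopy comes from
    [E] on the nose, by homotopy lifting ([strict_lift]); this gives
    surjectivity.  For injectivity, homotopies in [A] and in [E] are at hand
    which agree over [B] on the boundary of [I^(n+1)] only.  The homotopy [k] in
    [E] makes its own boundary contractible, so the problem of lifting the
    homotopy in [B] with this boundary deforms to one with constant boundary,
    which is solved by surjectivity of [A_(n+1)(p)] ([sphere_lift]).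

    A map [f : X -> Y] factors through the graph of pairs of a vertex [x] and an
    eventually constant path from [f x].  Constant paths form a deformation
    retract, by truncating paths ([const_path_weq]).  The end point map is a
    fibration because an open box of paths with prescribed ends is an open box
    in the cube of one dimension more ([mstop_fibration]). *)

Set Implicit Arguments.
Unset Strict Implicit.
Unset Printing Implicit Defensive.

Import Order.TTheory GRing.Theory Num.Theory.
Local Open Scope ring_scope.

(** * Faces and open boxes in the cube of integers *)

Lemma near_Iinf (s t : Iinf) : near s t <-> s <= t + 1 /\ t <= s + 1.
Proof. by rewrite /near /=; split; lia. Qed.

Lemma near_coord n (x y : Icube n) j : near x y -> near (x j) (y j).
Proof. by case/near_pow => [->//|[k h e]]; have [->|/e->] := eqVneq j k. Qed.

Lemma near_cube n (x y : Icube n) k : near (x k) (y k) ->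
  (forall j, j != k -> x j = y j) -> near x y.
Proof. by move=> h e; apply/near_pow; right; exists k. Qed.

Lemma updE n (x : 'I_n -> int) i t j : upd x i t j = if j == i then t else x j.
Proof. by []. Qed.

Lemma upd_id n (x : 'I_n -> int) i : upd x i (x i) = x.
Proof. by apply: functional_extensionality => j; rewrite updE; case: eqP => [->|]. Qed.

Lemma clampK n M (x : 'I_n -> int) M' : (M <= M')%N ->
  clamp M \o (clamp M' \o x) = clamp M \o x.
Proof. by move=> h; apply: functional_extensionality => j /=; rewrite /clamp; lia. Qed.

Lemma clamp_near n M (x y : Icube n) : near x y -> near (clamp M \o x : Icube n) (clamp M \o y).
Proof.
case/near_pow => [->//|[k /near_Iinf h e]]; apply: (@near_cube _ _ _ k).
  by apply/near_Iinf; rewrite /= /clamp; lia.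
by move=> j /e /= ->.
Qed.

Lemma stableW n (G : graph) M M' (f : ('I_n -> int) -> G) : (M <= M')%N ->
  stable M f -> stable M' f.
Proof.
move=> h /stable_clamp sf; apply/stable_clamp => x.
by rewrite -[LHS]sf clampK.
Qed.

Lemma stable_comp n (G H : graph) M (f : ('I_n -> int) -> G) (p : G -> H) :
  stable M f -> stable M (p \o f).
Proof. by move=> /stable_clamp sf; apply/stable_clamp => x /=; rewrite sf. Qed.

(** Faces are half-spaces rather than hyperplanes: a stable map does not vary
    beyond the hyperplane, so both carry the same data, and with half-spaces the
    size [M] can be increased without changing the map. *)
Definition on_face n (M : nat) (jd : 'I_n * bool) (x : 'I_n -> int) : bool :=
  if jd.2 then M%:Z <= x jd.1 else x jd.1 <= - M%:Z.

Definition in_box n (i : 'I_n) (e : bool) (M : nat) (x : 'I_n -> int) :=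
  exists2 jd, jd != (i, e) & on_face M jd x.

Lemma on_faceW n M M' jd (x : 'I_n -> int) : (M <= M')%N ->
  on_face M' jd x -> on_face M jd x.
Proof. by rewrite /on_face => h; case: ifP => _; lia. Qed.

Lemma in_boxW n (i : 'I_n) e M M' x : (M <= M')%N -> in_box i e M' x -> in_box i e M x.
Proof. by move=> h [jd ne f]; exists jd => //; apply: on_faceW f. Qed.

Lemma on_face_clamp n M jd (x : 'I_n -> int) :
  on_face M jd x -> on_face M jd (clamp M \o x).
Proof. by rewrite /on_face /= /clamp; case: ifP => _; lia. Qed.

Lemma in_box_clamp n (i : 'I_n) e M x : in_box i e M x -> in_box i e M (clamp M \o x).
Proof. by case=> jd ne f; exists jd => //; apply: on_face_clamp. Qed.

Lemma stable_on_face n (G : graph) M (f : ('I_n -> int) -> G) jd x : stable M f ->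
  on_face M jd x -> f (upd x jd.1 (int_end M jd.2)) = f x.
Proof.
move=> sf; have [h1 h2] := sf jd.1 x.
rewrite /on_face /int_end; case: ifP => _ h.
- have [E|ne] := eqVneq (x jd.1) M%:Z; first by rewrite -E upd_id.
  by rewrite h1 //; lia.
- have [E|ne] := eqVneq (x jd.1) (- M%:Z); first by rewrite -E upd_id.
  by rewrite h2 //; lia.
Qed.

(** Maps on a subset are encoded as total functions, whose values elsewhere are
    arbitrary. *)

Section Maps.
Variables (n : nat) (G : graph).

Definition near_on (S : ('I_n -> int) -> Prop) (u : ('I_n -> int) -> G) :=
  forall x y, S x -> S y -> near (x : Icube n) y -> near (u x) (u y).

Definition stable_on (S : ('I_n -> int) -> Prop) M (u : ('I_n -> int) -> G) :=
  forall x, S x -> u (clamp M \o x) = u x.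

End Maps.

Lemma near_onW n (G : graph) (i : 'I_n) e M M' (u : ('I_n -> int) -> G) :
  (M <= M')%N -> near_on (in_box i e M) u -> near_on (in_box i e M') u.
Proof. by move=> h nu x y hx hy; apply: nu; [apply: in_boxW hx|apply: in_boxW hy]. Qed.

Lemma stable_onW n (G : graph) (i : 'I_n) e M M' (u : ('I_n -> int) -> G) :
  (M <= M')%N -> stable_on (in_box i e M) M u -> stable_on (in_box i e M') M' u.
Proof.
move=> h su x hx; rewrite -[RHS]su; last exact: (in_boxW h hx).
rewrite -[LHS]su ?clampK //.
by apply: (in_boxW h); apply: in_box_clamp.
Qed.

(** * Open boxes of graph maps have fillers *)

Section Retraction.
Variables (n : nat) (i : 'I_n) (e : bool) (M : nat).

Definition spread (x : 'I_n -> int) : nat := \max_(j < n | j != i) absz (x j).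

(** The retraction onto the open box, where the face [i] with sign [e] is
    missing.  For [e = true] the [i]-th coordinate is pushed down to [- M] while
    the others are within [M], and released at unit speed once some other
    coordinate leaves this range; when that coordinate arrives at [3M], the
    bound is [M] and the [i]-th coordinate is only clamped.  So at any time a
    step in a direction [k <> i] moves either the clamped coordinate [k] or the
    bound on coordinate [i], but not both: this makes it a graph map for the box
    product. *)
Definition box_retr (x : 'I_n -> int) : 'I_n -> int := fun j =>
  clamp M (if j == i then
    if e then Num.min (x i) ((spread x)%:Z - (2 * M)%:Z)
    else Num.max (x i) ((2 * M)%:Z - (spread x)%:Z)
  else x j).

Lemma spread_ge x j : j != i -> (absz (x j) <= spread x)%N.
Proof. by move=> ji; rewrite /spread (bigD1 j) //= leq_maxl. Qed.

Lemma spread_upd x y k : k != i -> (forall j, j != k -> x j = y j) ->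
  exists m, spread x = maxn (absz (x k)) m /\ spread y = maxn (absz (y k)) m.
Proof.
move=> ki h; exists (\max_(j < n | (j != i) && (j != k)) absz (x j)).
rewrite /spread (bigD1 k) //= [\max_(_ < n | _) absz (y _)](bigD1 k) //=; split=> //.
by congr maxn; apply: eq_bigr => j /andP [_ /h ->].
Qed.

(** The only delicate case is a step in a direction [k <> i]: as long as [x_k]
    stays within [M], it can change the bound only at or below [- M]. *)
Lemma box_retr_near (x y : Icube n) : near x y -> near (box_retr x : Icube n) (box_retr y).
Proof.
case/near_pow => [->//|[k /near_Iinf [h1 h2] h]].
have [ki|ki] := eqVneq k i.
  have E : spread x = spread y by apply: eq_bigr => j ji; rewrite h // ki.
  apply: (@near_cube _ _ _ i) => [|j ji]; last by rewrite /box_retr (negPf ji) h ?ki.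
  by apply/near_Iinf; rewrite /box_retr eqxx E -ki /clamp; case: e; lia.
have [m [Ex Ey]] := spread_upd ki h.
have Ei : x i = y i by apply: h; rewrite eq_sym.
(* Coordinate [k] moves within [-M, M], and coordinate [i] stays. *)
have [hk|hk] := boolP ((absz (x k) <= M) && (absz (y k) <= M))%N.
  apply: (@near_cube _ _ _ k) => [|j jk].
    by apply/near_Iinf; rewrite /box_retr (negPf ki) /clamp; lia.
  rewrite /box_retr; case: ifP => _; last by rewrite h.
  by rewrite Ex Ey Ei /clamp; case: e; lia.
(* Coordinate [k] is clamped to a constant, and coordinate [i] may move. *)
apply: (@near_cube _ _ _ i) => [|j ji].
  by apply/near_Iinf; rewrite /box_retr eqxx Ex Ey Ei /clamp; case: e; lia.
rewrite /box_retr (negPf ji); have [->|/h->//] := eqVneq j k.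
by rewrite /clamp; lia.
Qed.

Lemma box_retr_in x : in_box i e M (box_retr x).
Proof.
have [h|h] := leqP M (spread x).
  have [M0|M0] := posnP M.
    exists (i, ~~ e); first by rewrite xpair_eqE eqxx; case: (e).
    by rewrite /on_face /box_retr /clamp /= M0; case: (e) => /=; lia.
  have [j ji hj] : exists2 j, j != i & absz (x j) = spread x.
    case: (pickP (fun j => j != i)) => [j0 j0i|no].
      exists [arg max_(j > j0 | j != i) absz (x j)].
        by case: arg_maxnP.
      by rewrite /spread (bigop.bigmax_eq_arg j0).
    by move: h; rewrite /spread big_pred0 //; lia.
  exists (j, 0 <= x j); first by rewrite xpair_eqE (negPf ji).
  by rewrite /on_face /box_retr /= (negPf ji) /clamp; case: ifP; lia.
exists (i, ~~ e); first by rewrite xpair_eqE eqxx; case: e.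
by rewrite /on_face /box_retr /= eqxx /clamp; case: e => /=; lia.
Qed.

Lemma box_retr_clamp x : in_box i e (3 * M) x -> box_retr x = clamp M \o x.
Proof.
case=> -[j d] jd hj; apply: functional_extensionality => k; rewrite /box_retr /=.
case: eqP => [->|//]; have [E|ji] := eqVneq j i.
  subst j; move: jd hj; rewrite /on_face /= /clamp xpair_eqE eqxx /=.
  by case: (e); case: d => //= _; lia.
have := spread_ge x ji; move: hj; rewrite /on_face /= /clamp.
by case: d {jd} => /=; case: (e); lia.
Qed.

Lemma spread_clamp M' x : spread (clamp M' \o x) = minn M' (spread x).
Proof.
rewrite /spread (big_morph (minn M') (id1 := 0%N) (op1 := maxn)); last by rewrite minn0.
  by apply: eq_bigr => j _ /=; rewrite /clamp; lia.
by move=> a b; lia.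
Qed.

Lemma box_retr_stable x : box_retr (clamp (3 * M) \o x) = box_retr x.
Proof.
apply: functional_extensionality => j; rewrite /box_retr spread_clamp /= /clamp.
by case: (j == i); case: (e); lia.
Qed.
End Retraction.

(** The filler is the composite of the open box with the retraction.  It extends
    the open box only on the faces of the larger cube, where the retraction
    clamps; since the box is stable this is no loss. *)
Lemma box_filler (G : graph) n (i : 'I_n) e M (u : ('I_n -> int) -> G) :
  near_on (in_box i e M) u -> stable_on (in_box i e M) M u ->
  exists l : gmap (Icube n) G,
    stable (3 * M) l /\ forall x, in_box i e (3 * M) x -> l x = u x.
Proof.
move=> nu su.
have hP (x y : Icube n) : near x y -> near (u (box_retr i e M x)) (u (box_retr i e M y)).
  by move=> h; apply: nu; [exact: box_retr_in|exact: box_retr_in|exact: box_retr_near].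
exists (Gmap (gfun := fun x : Icube n => u (box_retr i e M x)) hP); split.
  by apply/stable_clamp => x /=; rewrite box_retr_stable.
by move=> x hx /=; rewrite box_retr_clamp // su //; apply: in_boxW hx; lia.
Qed.

(** * Kan fibrations between nerves, in terms of graph maps *)

(** The lift may have a larger size [M'] than the data, as fillers spread out;
    the boundary condition is imposed on the faces of the larger cube. *)
Definition box_lifting (E B : graph) (p : gmap E B) :=
  forall n (i : 'I_n.+1) e M (u : ('I_n.+1 -> int) -> E) (w : gmap (Icube n.+1) B),
  stable M w -> near_on (in_box i e M) u -> stable_on (in_box i e M) M u ->
  (forall x, in_box i e M x -> p (u x) = w x) ->
  exists M' (l : gmap (Icube n.+1) E),
    [/\ (M <= M')%N, stable M' l, forall x, p (l x) = w x &
        forall x, in_box i e M' x -> l x = u x].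

Lemma insert_delete T n (i : 'I_n.+1) t (x : 'I_n.+1 -> T) j :
  insert i t (delete i x) j = if j == i then t else x j.
Proof.
rewrite /insert /delete; case: unliftP => [k|] ->; last by rewrite eqxx.
by rewrite eq_sym (negPf (neq_lift _ _)).
Qed.

Lemma insert_delete_upd n (i : 'I_n.+1) t (x : 'I_n.+1 -> int) :
  insert i t (delete i x) = upd x i t.
Proof. by apply: functional_extensionality => j; rewrite insert_delete. Qed.

Lemma delete_insert T n (i : 'I_n.+1) t (x : 'I_n -> T) : delete i (insert i t x) = x.
Proof. by apply: functional_extensionality => j; rewrite /insert /delete liftK. Qed.

(** Words with the same Boolean action have integer actions that compare in the
    same way with every threshold in [(- M, M]]; clamping forgets the rest. *)
Lemma clamp_word_ext M m n (w w' : word m n) x : word_bool w = word_bool w' ->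
  clamp M \o word_int M w x = clamp M \o word_int M w' x.
Proof.
move=> e; apply: (@word_int_ext n (Icube n) M (fun x => clamp M \o x : Icube n)) => //.
by apply/stable_clamp => y; rewrite clampK.
Qed.

(** A step moves a single coordinate, so a step inside an open box stays inside
    one of the faces: for [0 < M] it cannot lead from a face to the opposite one. *)
Lemma near_common_face n (i : 'I_n) e M (x y : Icube n) : (0 < M)%N ->
  in_box i e M x -> in_box i e M y -> near x y ->
  exists2 jd, jd != (i, e) & on_face M jd x && on_face M jd y.
Proof.
move=> M0 [[j d] jn hx] [[k d'] kn hy] /near_pow [E|[l /near_Iinf h E]].
  by exists (j, d); rewrite // -E hx.
have [jl|jl] := eqVneq j l; last first.
  by exists (j, d); rewrite // hx /on_face /= -E.
have [kl|kl] := eqVneq k l; last first.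
  by exists (k, d'); rewrite // hy andbT /on_face /= E.
subst; have dd : d = d' by move: hx hy; rewrite /on_face /=; case: (d); case: (d') => //; lia.
by subst; exists (l, d'); rewrite // hx hy.
Qed.

Section KanToBox.
Variables (E B : graph) (p : gmap E B) (n : nat) (i : 'I_n.+1) (e : bool) (M : nat).
Variables (u : ('I_n.+1 -> int) -> E).
Hypothesis nu : near_on (in_box i e M) u.

Let box_point m (w : word m n.+1) (x : 'I_m -> int) := clamp M \o word_int M w x.

Lemma in_box_word m (phi : cube n.+1 m) : in_open_box i e phi ->
  forall x, in_box i e M (box_point (word_of phi) x).
Proof.
case=> j [d [ne [psi E0]]] x; exists (j, d); first exact/eqP.
rewrite /box_point (@clamp_word_ext _ _ _ _ (Wcomp (Wface j d) (word_of psi))).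
  by rewrite /on_face /= /word_int /= /insert unlift_none /clamp; case: (d) => /=; lia.
by rewrite -word_ofK E0 /= word_ofK.
Qed.

Lemma box_cell_near m (phi : cube n.+1 m) : in_open_box i e phi ->
  forall x y : Icube m, near x y ->
  near (u (box_point (word_of phi) x)) (u (box_point (word_of phi) y)).
Proof.
move=> h x y xy; apply: nu; [exact: in_box_word|exact: in_box_word|].
by apply: clamp_near; apply: word_int_near.
Qed.

Lemma box_cell_stable m (phi : cube n.+1 m) :
  stable M (fun x => u (box_point (word_of phi) x)).
Proof.
by apply/stable_clamp => x; congr u; rewrite /box_point -(word_int_clamp _ _ (leqnn M)) clampK.
Qed.

(** The cell of the open box at [phi] is [u] composed with the integer action of
    [phi]: as [phi] factors through a face, after clamping this action ends on
    that face, where [u] is meaningful. *)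
Definition box_cell m (c : open_box i e m) : cell E m :=
  Cell (cfun := Gmap (gfun := fun x : Icube m => u (box_point (word_of (sval c)) x))
      (box_cell_near (svalP c)))
    (ex_intro (fun M => stable M _) M (box_cell_stable (sval c))).

Lemma box_cell_nat m m' (c : open_box i e m') (f : @hom box_cat m m') :
  box_cell (act c f) = nerve_act (box_cell c) f.
Proof.
apply: cell_eq => x; have sc := box_cell_stable (sval c).
rewrite (@nerve_actE _ _ _ (box_cell c) f M _ x sc (word_ofK f)) /=.
congr u; apply: (@clamp_word_ext _ _ _ _ (Wcomp (word_of (sval c)) (word_of f))).
by rewrite -word_ofK /= !word_ofK.
Qed.

Definition box_trans : @hom cset_cat (open_box i e) (nerve_obj E) :=
  @NatTrans box_cat (open_box i e) (nerve_obj E) box_cell box_cell_nat.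
End KanToBox.

Definition yoneda G n (c : cell G n) : @hom cset_cat (cube n) (nerve_obj G) :=
  @NatTrans box_cat (cube n) (nerve_obj G) (fun m phi => nerve_act c phi)
    (fun m m' phi f => nerve_actM c phi f).

(** By Yoneda, the lift is the value of a lifting transformation on the
    identity; its faces are compared with [u] by naturality. *)
Lemma kan_box_lifting (E B : graph) (p : gmap E B) :
  nerve_fibration (X := E) (Y := B) p -> box_lifting p.
Proof.
move=> kp n i e M u w sw nu su pu.
pose wc : cell B n.+1 := Cell (ex_intro (fun M => stable M w) M sw).
have [|L [Lu Lw]] := kp n i e (box_trans nu) (yoneda wc).
  apply: nat_trans_eq => m c; apply: cell_eq => x /=.
  rewrite pu; last by apply: in_box_word; apply: (svalP c).
  symmetry; apply: etrans (@nerve_actE _ _ _ wc _ M _ x sw (word_ofK (sval c))) _.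
  by have /stable_clamp -> := sw.
pose c0 : cube n.+1 n.+1 := box_gen (Wid n.+1).
pose l : cell E n.+1 := (L : nat_trans _ _) _ c0.
have sl : stable (maxn M (sbound l)) l by apply: stableW (sboundP l); apply: leq_maxr.
exists (maxn M (sbound l)), l; split=> //; first exact: leq_maxl.
  move=> x; have := congr1 (fun t : nat_trans (cube n.+1) (nerve_obj B) =>
    (t _ c0 : cell B n.+1) x) Lw.
  by move=> h; apply: etrans h _; apply: (@nerve_actE _ _ _ wc c0 M (Wid n.+1) x sw).
move=> x [[j d] ne hx].
rewrite -(stable_on_face sl hx) /= -insert_delete_upd -(nerve_face _ _ _ sl).
have ob : in_open_box i e (face j d : cube n.+1 n).
  exists j, d; split; first exact/eqP.
  by exists (box_gen (Wid n)); apply: box_hom_eq.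
pose c : open_box i e n := exist _ _ ob.
have -> : nerve_act l (face j d) = (L : nat_trans _ _) _ (face j d : cube n.+1 n).
  rewrite -[face j d in RHS](@comp1m box_cat).
  by rewrite (nt_nat L (X := n : box_cat) (Y := n.+1 : box_cat) c0 (face j d)).
have := congr1 (fun t : nat_trans (open_box i e) (nerve_obj E) =>
  (t _ c : cell E n) (delete j x)) Lu.
move=> /= ->; rewrite (@clamp_word_ext _ _ _ _ (Wface j d)); last first.
  by rewrite -word_ofK.
have hx' : on_face M (j, d) x by apply: on_faceW hx; apply: leq_maxl.
rewrite -[RHS]su; last by exists (j, d).
congr u; apply: functional_extensionality => k.
rewrite /word_int /= insert_delete; case: eqP => [->|//].
by move: hx'; rewrite /on_face /clamp /=; case: (d) => /=; lia.
Qed.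

Lemma fin_bound (T : finType) (P : T -> nat -> Prop) :
  (forall t M M', (M <= M')%N -> P t M -> P t M') ->
  (forall t, exists M, P t M) -> exists M, forall t, P t M.
Proof.
move=> mono /(@choice _ _ _) [b hb].
by exists (\max_t b t) => t; apply: mono (hb t); apply: leq_bigmax.
Qed.

Section BoxToKan.
Variables (G : graph) (n : nat) (i : 'I_n.+1) (e : bool).
Variable U : nat_trans (open_box i e) (nerve_obj G).

(** Cells on faces are pulled back along the idempotents that collapse the cube
    onto a face.  All cells then have the same dimension, and two faces are
    compatible because their idempotents commute. *)
Definition face_proj (jd : 'I_n.+1 * bool) : box_hom n.+1 n.+1 :=
  box_gen (Wcomp (Wface jd.1 jd.2) (Wdegen jd.1)).

Lemma face_proj_in jd : jd != (i, e) ->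
  in_open_box i e (face_proj jd : cube n.+1 n.+1).
Proof.
move=> /eqP ne; exists jd.1, jd.2; split; first by case: jd ne.
by exists (degen jd.1); apply: box_hom_eq.
Qed.

Lemma face_in jd : jd != (i, e) ->
  in_open_box i e (face jd.1 jd.2 : cube n.+1 n).
Proof.
move=> /eqP ne; exists jd.1, jd.2; split; first by case: jd ne.
by exists (box_gen (Wid n)); apply: box_hom_eq.
Qed.

Definition face_elt jd (h : jd != (i, e)) : open_box i e n := exist _ _ (face_in h).

Definition proj_elt jd (h : jd != (i, e)) : open_box i e n.+1 :=
  exist _ _ (face_proj_in h).

Lemma opposite_neq : (i, ~~ e) != (i, e).
Proof. by rewrite xpair_eqE eqxx; case: e. Qed.

(** The family is made total, with a dummy value at the missing face, so that
    a common stability bound exists. *)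
Definition face_cell jd : cell G n.+1 :=
  if @idP (jd != (i, e)) is ReflectT h then U _ (proj_elt h)
  else U _ (proj_elt opposite_neq).

Lemma face_cellE jd (h : jd != (i, e)) : face_cell jd = U _ (proj_elt h).
Proof.
rewrite /face_cell; case: {-}_ / idP => [h'|//].
by rewrite (proof_irrelevance _ h h').
Qed.

Lemma open_box_eq m (a b : open_box i e m) : sval a = sval b -> a = b.
Proof. by move=> h; apply: eq_sig_hprop => // *; apply: proof_irrelevance. Qed.

(** On two different faces, both cells are computed by the composite of the two
    collapses, which lies in both faces. *)
Lemma face_cell_compat jd jd' M x : (0 < M)%N ->
  stable M (face_cell jd) -> stable M (face_cell jd') ->
  jd != (i, e) -> jd' != (i, e) -> on_face M jd x -> on_face M jd' x ->
  face_cell jd x = face_cell jd' x.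
Proof.
move=> M0 s s' h h' hx hx'.
have [jj|jj] := eqVneq jd.1 jd'.1.
  suff -> : jd = jd' by [].
  case: jd jd' {h h' s s'} jj hx hx' => [j d] [j' d'] /= -> .
  by rewrite /on_face /=; case: d; case: d' => //; lia.
have : nerve_act (face_cell jd) (face_proj jd') = nerve_act (face_cell jd') (face_proj jd).
  rewrite (face_cellE h) (face_cellE h').
  apply: etrans (esym (nt_nat U (proj_elt h) (face_proj jd' : @hom box_cat n.+1 n.+1))) _.
  apply: etrans _ (nt_nat U (proj_elt h') (face_proj jd : @hom box_cat n.+1 n.+1)).
  congr (U _ _); apply: open_box_eq; apply: box_hom_eq.
  apply: functional_extensionality => y; apply: functional_extensionality => k.
  rewrite /= /word_bool /= !insert_delete.
  by have [->|//] := eqVneq k jd.1; rewrite (negPf jj).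
move=> /(congr1 (fun c : cell G n.+1 => c x)).
rewrite (nerve_actE (w := Wcomp (Wface jd'.1 jd'.2) (Wdegen jd'.1)) x s) //.
rewrite (nerve_actE (w := Wcomp (Wface jd.1 jd.2) (Wdegen jd.1)) x s') //.
by rewrite /word_int /= !insert_delete_upd !stable_on_face.
Qed.

Lemma face_cells_glue : exists M (u : ('I_n.+1 -> int) -> G),
  [/\ (0 < M)%N, near_on (in_box i e M) u, stable_on (in_box i e M) M u,
      forall jd, stable M (face_cell jd) &
      forall jd x, jd != (i, e) -> on_face M jd x -> u x = face_cell jd x].
Proof.
have [M0 hM0] : exists M, forall jd, stable M (face_cell jd).
  apply: fin_bound => [jd M M'|jd]; first exact: stableW.
  by exists (sbound (face_cell jd)); apply: sboundP.
have hM jd : stable M0.+1 (face_cell jd) by apply: stableW (hM0 jd).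
set M := M0.+1 in hM.
pose u x := if [pick jd | (jd != (i, e)) && on_face M jd x] is Some jd
  then face_cell jd x else face_cell (i, ~~ e) x.
have uE jd x : jd != (i, e) -> on_face M jd x -> u x = face_cell jd x.
  move=> h hx; rewrite /u; case: pickP => [jd' /andP [h' hx']|/(_ jd)]; last by rewrite h hx.
  exact: (@face_cell_compat _ _ M).
exists M, u; split=> // [x y hx hy xy|x [jd h hx]].
  have [//|jd h /andP [hx' hy']] := near_common_face _ hx hy xy.
  by rewrite !(uE jd) //; apply: gfunP.
rewrite !(uE jd) ?on_face_clamp //.
by have /stable_clamp -> := hM jd.
Qed.
End BoxToKan.

(** The faces glue to a function [u] on the open box.  A lift of it acts on box
    morphisms, and agrees with the given transformation since both are
    determined by their values on the faces. *)
Lemma box_lifting_kan (E B : graph) (p : gmap E B) :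
  box_lifting p -> nerve_fibration (X := E) (Y := B) p.
Proof.
move=> bp n i e U W UW.
have [M0 [u [M00 nu su sF uF]]] := face_cells_glue U.
pose c0 : cube n.+1 n.+1 := box_gen (Wid n.+1).
pose w : cell B n.+1 := (W : nat_trans (cube n.+1) (nerve_obj B)) _ c0.
have WE m (phi : cube n.+1 m) :
    (W : nat_trans (cube n.+1) (nerve_obj B)) _ phi = nerve_act w phi.
  rewrite -[phi in LHS](@comp1m box_cat).
  exact: (nt_nat W (X := m : box_cat) (Y := n.+1 : box_cat) c0 phi).
pose M := maxn M0 (sbound w).
have M0M : (M0 <= M)%N by apply: leq_maxl.
have sw : stable M w by apply: stableW (sboundP w); apply: leq_maxr.
have [|M' [l [MM' sl pl lu]]] :=
    bp n i e M u w sw (near_onW M0M nu) (stable_onW M0M su).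
  move=> x [jd h hx]; have hx0 : on_face M0 jd x by apply: on_faceW hx.
  rewrite (uF jd) // (face_cellE U h).
  have := congr1 (fun t : nat_trans (open_box i e) (nerve_obj B) =>
    (t _ (proj_elt h) : cell B n.+1) x) UW.
  move=> H; apply: etrans H _; rewrite /= WE.
  rewrite (@nerve_actE _ _ _ w _ M (Wcomp (Wface jd.1 jd.2) (Wdegen jd.1)) x sw) //.
  by rewrite /word_int /= insert_delete_upd stable_on_face.
have sl' : exists M, stable M l by exists M'.
pose lc : cell E n.+1 := Cell sl'.
exists (yoneda lc); split.
- apply: nat_trans_eq => m [phi ob]; have [j [d [ne [psi E0]]]] := ob.
  have h : (j, d) != (i, e) by apply/eqP.
  have Ephi : exist _ phi ob =
      act (face_elt h : open_box i e (n : box_cat)) (psi : @hom box_cat m n).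
    exact: open_box_eq.
  change (nerve_act lc phi = (U : nat_trans (open_box i e) (nerve_obj E)) m (exist _ phi ob)).
  rewrite Ephi nt_nat E0.
  apply: etrans (nerve_actM lc (face j d) psi) _.
  apply: (congr1 (fun c : cell E n => nerve_act c psi)).
  have Eface : face_elt h = act (proj_elt h : open_box i e (n.+1 : box_cat))
      (face j d : @hom box_cat n n.+1).
    apply: open_box_eq; apply: box_hom_eq; apply: functional_extensionality => y.
    by rewrite /= /word_bool /= delete_insert.
  rewrite Eface nt_nat -face_cellE; apply: cell_eq => x.
  have sF' : stable M' (face_cell U (j, d)) by apply: stableW (sF _); apply: leq_trans MM'.
  rewrite (@nerve_face _ _ lc j d M' x sl) (@nerve_face _ _ (face_cell U (j, d)) j d M' x sF') /=.
  have hx : on_face M' (j, d) (insert j (int_end M' d) x).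
    by rewrite /on_face /= /insert unlift_none /int_end; case: (d).
  rewrite lu; last by exists (j, d).
  by apply: uF => //; apply: on_faceW hx; apply: leq_trans MM'.
- apply: nat_trans_eq => m phi; rewrite WE.
  apply: etrans (nerve_cell_nat p lc phi) _; congr nerve_act.
  exact: cell_eq.
Qed.

Lemma nerve_fibrationP (E B : graph) (p : gmap E B) :
  nerve_fibration (X := E) (Y := B) p <-> box_lifting p.
Proof. by split; [exact: kan_box_lifting|exact: box_lifting_kan]. Qed.

(** * Homotopies as cells *)

(** Homotopies are maps on [I^(n+1)], with the last coordinate as the time. *)
Definition base n (y : 'I_n.+1 -> int) : 'I_n -> int := delete ord_max y.
Definition time n (y : 'I_n.+1 -> int) : int := y ord_max.
Definition at_time n (t : int) (x : 'I_n -> int) : 'I_n.+1 -> int := insert ord_max t x.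

Lemma base_at n t (x : 'I_n -> int) : base (at_time t x) = x.
Proof. exact: delete_insert. Qed.

Lemma time_at n t (x : 'I_n -> int) : time (at_time t x) = t.
Proof. by rewrite /time /at_time /insert unlift_none. Qed.

Lemma at_base n (y : 'I_n.+1 -> int) : at_time (time y) (base y) = y.
Proof. by rewrite /at_time /base insert_delete_upd upd_id. Qed.

Lemma clamp_base n M (y : 'I_n.+1 -> int) : base (clamp M \o y) = clamp M \o base y.
Proof. by []. Qed.

Lemma clamp_at n M t (x : 'I_n -> int) :
  clamp M \o at_time t x = at_time (clamp M t) (clamp M \o x).
Proof.
by apply: functional_extensionality => j; rewrite /= /at_time /insert; case: unlift.
Qed.

Lemma near_base_time n (y z : Icube n.+1) : near y z ->
  (base y = base z /\ near (time y : Iinf) (time z)) \/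
  (time y = time z /\ near (base y : Icube n) (base z)).
Proof.
move=> yz; pose p (y : Icube n.+1) : prod_graph (Icube n) Iinf := (base y, time y).
have E (x : Icube n.+1) : pow_snoc (p x) = x := at_base x.
by rewrite -(E y) -(E z) in yz; move/pow_snoc_near/near_prod: yz.
Qed.

Lemma near_at n t (x y : Icube n) : near x y ->
  near (at_time t x : Icube n.+1) (at_time t y).
Proof.
by move=> h; apply: (pow_snoc_near (G := Iinf) (x, t) (y, t)).2; apply/near_prod; right.
Qed.

Lemma near_at_time n (s t : Iinf) (x : Icube n) : near s t ->
  near (at_time s x : Icube n.+1) (at_time t x).
Proof.
by move=> h; apply: (pow_snoc_near (G := Iinf) (x, s) (x, t)).2; apply/near_prod; left.
Qed.

Lemma near_int (G : graph) (h : int -> G) :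
  (forall t, near (h t) (h (t + 1))) -> forall s t : Iinf, near s t -> near (h s) (h t).
Proof.
move=> H s t [->//|[|] ->]; first exact: H.
by apply: near_sym; apply: H.
Qed.

Lemma cylinder_near n (G : graph) (h : ('I_n -> int) -> int -> G) :
  (forall (x y : Icube n) t, near x y -> near (h x t) (h y t)) ->
  (forall x t, near (h x t) (h x (t + 1))) ->
  forall y z : Icube n.+1, near y z -> near (h (base y) (time y)) (h (base z) (time z)).
Proof.
move=> hx ht y z /near_base_time [[-> E]|[-> E]]; last exact: hx.
exact: (near_int (h := h (base z))).
Qed.

Definition cylinder_map n (G : graph) (h : ('I_n -> int) -> int -> G) hx ht :
  gmap (Icube n.+1) G := Gmap (cylinder_near (h := h) hx ht).

Definition slice n (G : graph) (k : gmap (Icube n.+1) G) (t : int) : gmap (Icube n) G :=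
  @Gmap (Icube n) G (fun x => k (at_time t x)) (fun x y h => gfunP k (near_at t h)).

Lemma slice_stable n (G : graph) (k : gmap (Icube n.+1) G) t M :
  stable M k -> stable M (slice k t).
Proof.
move=> /stable_clamp sk; apply/stable_clamp => x.
by rewrite /= -(sk (at_time t _)) -[RHS]sk !clamp_at clampK.
Qed.

Lemma far_clamp n M (x : 'I_n -> int) : far M x -> far M (clamp M \o x).
Proof. by case=> i hi; exists i; rewrite /= /clamp; lia. Qed.

Lemma farW n M M' (x : 'I_n -> int) : (M <= M')%N -> far M' x -> far M x.
Proof. by move=> h [i hi]; exists i; apply: leq_trans hi. Qed.

Lemma not_far_clamp n M (x : 'I_n -> int) : ~ far M x -> clamp M \o x = x.
Proof.
move=> h; apply: functional_extensionality => j.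
have : ~~ (M <= absz (x j))%N by apply/negP => ?; apply: h; exists j.
by rewrite /= /clamp; lia.
Qed.

Lemma farP n M (x : 'I_n -> int) : far M x \/ ~ far M x.
Proof.
case: (boolP [exists i, (M <= absz (x i))%N]) => [/existsP|/existsP]; [by left|by right].
Qed.

Lemma const_far_stable n (G : graph) (v : G) M (f : ('I_n -> int) -> G) :
  const_far M v f -> stable M f.
Proof.
move=> cf; apply/stable_clamp => x; have [h|h] := farP M x.
  by rewrite !cf //; apply: far_clamp.
by rewrite not_far_clamp.
Qed.

Section Cylinder.
Variables (n : nat) (G : graph) (v : G).

(** A based homotopy whose time runs over all integers is a cell of the nerve;
    in this form, box lifting applies to it. *)
Record cylinder (f g : ('I_n -> int) -> G) (M : nat) (k : gmap (Icube n.+1) G) : Prop :=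
  Cylinder {
    cyl_start : forall y, time y <= - M%:Z -> k y = f (base y);
    cyl_end : forall y, M%:Z <= time y -> k y = g (base y);
    cyl_far : forall y, far M (base y) -> k y = v }.

Lemma cylinderW f g M M' k : (M <= M')%N -> cylinder f g M k -> cylinder f g M' k.
Proof.
move=> h [h0 h1 hf]; split=> y hy; [apply: h0; lia|apply: h1; lia|].
by apply: hf; apply: farW hy.
Qed.

Lemma cylinder_stable f g M k : cylinder f g M k -> stable M k.
Proof.
case=> h0 h1 hf; apply/stable_clamp => y.
have [hy|hy] := farP M (base y).
  by rewrite !hf // clamp_base; apply: far_clamp.
have E : base (clamp M \o y) = base y by rewrite clamp_base not_far_clamp.
have [hs|hs] := lerP (time y) (- M%:Z).
  by rewrite !h0 ?E // /time /= /clamp -/(time y); lia.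
have [ht|ht] := lerP M%:Z (time y).
  by rewrite !h1 ?E // /time /= /clamp -/(time y); lia.
rewrite -[in RHS](at_base y) -(at_base (clamp M \o y)) E; congr (k (at_time _ _)).
by rewrite /time /= /clamp -/(time y); lia.
Qed.

Lemma homotopic_cylinder (f g : bmap n v) :
  homotopic f g -> exists M k, cylinder f g M k.
Proof.
case=> m [eta [e0 e1 [K cK]]].
pose clip (t : int) : nat := minn m (if t <= 0 then 0 else absz t).
have hx (x y : Icube n) t : near x y ->
    near (eta (x, inord (clip t))) (eta (y, inord (clip t))).
  exact: gmap_prodl.
have ht x t : near (eta (x, inord (clip t))) (eta (x, inord (clip (t + 1)))).
  by apply: gmap_prodr; apply/Ifin_near; rewrite !inordK /clip; try lia;
    case: ifP => h1; case: ifP => h2; case: (leqP m (absz t)) => h3;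
    first [constructor 1; lia|constructor 2; lia].
exists (K + m)%N, (cylinder_map hx ht); split=> y hy /=.
- by rewrite -e0; congr (eta (_, _)); apply: val_inj; rewrite /= inordK /clip; case: ifP; lia.
- by rewrite -e1; congr (eta (_, _)); apply: val_inj; rewrite /= inordK /clip; case: ifP; lia.
- by apply: cK; apply: farW hy; lia.
Qed.

Lemma cylinder_homotopic (f g : bmap n v) M k : cylinder f g M k -> homotopic f g.
Proof.
case=> h0 h1 hf.
pose h (p : prod_graph (Icube n) (Ifin (2 * M))) : G := k (at_time (p.2%:Z - M%:Z) p.1).
have hP : forall p q, near p q -> near (h p) (h q).
  apply: prod_near => [a a' b aa'|a b b' /Ifin_near bb']; apply: gfunP => /=.
    exact: near_at.
  by apply: near_at_time; apply/near_Iinf; case: bb'; lia.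
exists (2 * M)%N, (Gmap hP); split=> [x|x|]; rewrite /= /h /=.
- by rewrite h0 ?base_at // time_at; lia.
- by rewrite h1 ?base_at // time_at; lia.
- by exists M => t x hx; rewrite hf // base_at.
Qed.
End Cylinder.

(** * Weak homotopy equivalences *)

Lemma homotopic_postcomp n (G H : graph) (p : gmap G H) v (f g : bmap n v) :
  homotopic f g -> homotopic (postcomp p f) (postcomp p g).
Proof.
case=> m [eta [e0 e1 [K cK]]]; exists m, (gmap_comp p eta).
split=> [x|x|]; rewrite /= ?e0 ?e1 //.
by exists K => t x /cK /= ->.
Qed.

(** Postcomposition commutes with concatenation on the nose, so that
    isomorphisms of A-groups are just bijections. *)
Lemma Amap_morph n (G H : graph) (p : gmap G H) v (i : 'I_n) (a b : Agroup n v) :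
  Amap p (Amul i a b) = Amul i (Amap p a) (Amap p b).
Proof.
rewrite -(reprK a) -(reprK b); set f := repr a; set g := repr b.
rewrite -!/(Acls _) (Amul_cls (h := concat i f g) (boundP (f := f)) (boundP (f := g))) //.
rewrite !Amap_cls; symmetry; apply: (Amul_cls (M := bound f) (N := bound g)).
- by move=> x /boundP /= ->.
- by move=> x /boundP /= ->.
- by move=> x; rewrite /= /concat_fun; case: ifP.
Qed.

Definition A_injective n (G H : graph) (p : gmap G H) (v : G) :=
  forall f g : bmap n v, homotopic (postcomp p f) (postcomp p g) -> homotopic f g.

Definition A_surjective n (G H : graph) (p : gmap G H) (v : G) :=
  forall g : bmap n (p v), exists f : bmap n v, homotopic (postcomp p f) g.

Definition A_bijective n (G H : graph) (p : gmap G H) (v : G) :=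
  A_injective n p v /\ A_surjective n p v.

Lemma Amap_isoP n (G H : graph) (p : gmap G H) v :
  Amap_iso n p v <-> A_bijective n p v.
Proof.
split=> [[[q pq qp] _]|[inj surj]].
  split=> [f g /AclsP|g].
    by rewrite -!Amap_cls => /(can_inj pq) /AclsP.
  exists (repr (q (Acls g))); apply/AclsP.
  by rewrite -Amap_cls -{2}(qp (Acls g)); congr Amap; apply: reprK.
split; last exact: Amap_morph.
have preim (b : Agroup n (p v)) : exists a : Agroup n v, Amap p a = b.
  have [f hf] := surj (repr b); exists (Acls f); rewrite Amap_cls -(reprK b).
  exact/AclsP.
have [q qP] := choice _ preim; exists q => // a.
have := qP (Amap p a); rewrite -(reprK a) -(reprK (q _)) -!/(Acls _) !Amap_cls.
by move=> /AclsP /inj /AclsP.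
Qed.

Lemma weqP (G H : graph) (p : gmap G H) : weak_homotopy_equiv p <->
  (forall v n, A_bijective n p v) /\ (inhabited H -> inhabited G).
Proof.
by split=> -[h hi]; split=> // v n; have := h v n => /Amap_isoP.
Qed.

(** * Deforming lifting problems on spheres *)

(** A cylinder without one of its ends is an open box. *)
Lemma in_box_time N M d (y : 'I_N.+1 -> int) :
  in_box ord_max (~~ d) M y <-> far M (base y) \/ on_face M (ord_max, d) y.
Proof.
split=> [[[j c] ne]|[[j hj]|h]].
- case: (unliftP ord_max j) ne => [k|] -> ne h; [left; exists k|right].
    by move: h; rewrite /on_face /= /base /delete; case: (c); lia.
  by move: ne h; rewrite xpair_eqE eqxx /=; case: (c); case: (d).
- exists (lift ord_max j, 0 <= base y j).
    by rewrite xpair_eqE eq_sym (negPf (neq_lift _ _)).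
  by move: hj; rewrite /on_face /= /base /delete; case: ifP; lia.
- by exists (ord_max, d) => //; rewrite xpair_eqE eqxx; case: d {h}.
Qed.

Section Glue.
Variables (N : nat) (G : graph) (M : nat) (d : bool).
Variables (U : gmap (Icube N.+1) G) (l : gmap (Icube N) G).
Hypotheses (sU : stable M U) (sl : stable M l).
Hypothesis lU : forall x, far M x -> l x = U (at_time (int_end M d) x).

(** The sides of a cylinder and one of its ends, as a function on the open box
    that lacks the other end. *)
Definition glue (y : 'I_N.+1 -> int) : G :=
  if on_face M (ord_max, d) y then l (base y) else U y.

Lemma glue_side y : far M (base y) -> glue y = U y.
Proof.
move=> h; rewrite /glue; case: ifP => // hy.
by rewrite lU // -[RHS](stable_on_face sU hy) /= /at_time /base insert_delete_upd.
Qed.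

Lemma glue_near : near_on (in_box ord_max (~~ d) M) glue.
Proof.
have far_glue y : in_box ord_max (~~ d) M y -> ~~ on_face M (ord_max, d) y ->
    far M (base y) by move=> /in_box_time [//|->].
have key y z : in_box ord_max (~~ d) M z -> near (y : Icube N.+1) z ->
    on_face M (ord_max, d) y -> ~~ on_face M (ord_max, d) z -> near (glue y) (glue z).
  move=> hz yz fy fz.
  have [[E _]|[E _]] := near_base_time yz.
    have h := far_glue _ z hz fz.
    by rewrite !glue_side ?E //; apply: gfunP.
  by move: fy fz; rewrite /on_face /= -!/(time _) E => ->.
move=> y z hy hz yz.
case: (boolP (on_face M (ord_max, d) y)) => fy; case: (boolP (on_face M (ord_max, d) z)) => fz.
- rewrite /glue fy fz; apply: gfunP.
  by have [[-> _]|[]] := near_base_time yz.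
- exact: key.
- by apply: near_sym; apply: key => //; apply: near_sym.
- by rewrite /glue (negPf fy) (negPf fz); apply: gfunP.
Qed.

Lemma glue_stable : stable_on (in_box ord_max (~~ d) M) M glue.
Proof.
move=> y /in_box_time [h|h].
  rewrite !glue_side ?clamp_base //; last exact: far_clamp.
  by have /stable_clamp -> := sU.
rewrite /glue h on_face_clamp // clamp_base.
by have /stable_clamp -> := sl.
Qed.
End Glue.

(** Homotopy lifting relative to the boundary is box lifting with the final end
    missing.  [U] stands for its restriction to the sides of the cylinder. *)
Lemma homotopy_lifting (E B : graph) (p : gmap E B) N M
    (U : gmap (Icube N.+1) E) (W : gmap (Icube N.+1) B) (l0 : gmap (Icube N) E) :
  box_lifting p -> stable M U -> stable M W -> stable M l0 ->
  (forall y, far M (base y) -> p (U y) = W y) ->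
  (forall x, p (l0 x) = W (at_time (- M%:Z) x)) ->
  (forall x, far M x -> l0 x = U (at_time (- M%:Z) x)) ->
  exists M' (l1 : gmap (Icube N) E),
    [/\ stable M' l1, forall x, p (l1 x) = W (at_time M%:Z x) &
        forall x, far M' x -> l1 x = U (at_time M%:Z x)].
Proof.
move=> bp sU sW sl pU pl lU.
have lU' x : far M x -> l0 x = U (at_time (int_end M false) x) := @lU x.
have [|M' [l [MM' sl' pl' lu]]] := bp N ord_max true M (glue M false U l0) W sW
  (glue_near sU lU') (glue_stable sU sl lU').
  move=> y /(@in_box_time _ _ false) [h|h]; first by rewrite glue_side // pU.
  rewrite /glue h pl -[RHS](stable_on_face sW h) /=.
  by rewrite /at_time /base insert_delete_upd.
exists M', (slice l M'%:Z); split.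
- exact: slice_stable.
- move=> x; rewrite /= pl' -[in LHS]((stable_clamp M W).1 sW) -[in RHS]((stable_clamp M W).1 sW).
  by rewrite !clamp_at /clamp; congr (W (at_time _ _)); lia.
- move=> x hx; have hxM : far M x by apply: farW hx.
  rewrite /= lu; last by apply/(@in_box_time _ _ false); left; rewrite base_at.
  rewrite glue_side ?base_at // -[in LHS]((stable_clamp M U).1 sU).
  rewrite -[in RHS]((stable_clamp M U).1 sU).
  by rewrite !clamp_at /clamp; congr (U (at_time _ _)); lia.
Qed.

(** A lifting problem against the boundary of a cube; [u] stands for its
    restriction to the boundary. *)
Definition solvable (E B : graph) (p : gmap E B) N
    (u : gmap (Icube N) E) (w : gmap (Icube N) B) :=
  exists M (l : gmap (Icube N) E),
    [/\ stable M l, forall x, p (l x) = w x & forall x, far M x -> l x = u x].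

(** Deforming the boundary condition of a lifting problem along [U] backwards in
    time: the deformation of [w] exists as [B] is fibrant, and once the problem
    is solved at the initial time, homotopy lifting carries the solution back. *)
Lemma solvable_deform (E B : graph) (p : gmap E B) N M
    (U : gmap (Icube N.+1) E) (w : gmap (Icube N) B) :
  box_lifting p -> stable M U -> stable M w ->
  (forall x, far M x -> p (U (at_time M%:Z x)) = w x) ->
  (forall M' (w' : gmap (Icube N) B), (M <= M')%N -> stable M' w' ->
    (forall x, far M' x -> p (U (at_time (- M%:Z) x)) = w' x) ->
    solvable p (slice U (- M%:Z)) w') ->
  solvable p (slice U M%:Z) w.
Proof.
move=> bp sU sw pU H.
have sUt t t' x K : (M <= K)%N -> clamp M t = clamp M t' ->
    U (at_time t x) = U (at_time t' x).
  move=> _ E0; rewrite -[in LHS]((stable_clamp M U).1 sU).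
  by rewrite -[in RHS]((stable_clamp M U).1 sU) !clamp_at E0.
have spU : stable M (gmap_comp p U) by apply: (stable_comp p sU).
have pU' x : far M x -> w x = gmap_comp p U (at_time (int_end M true) x).
  by move=> h; rewrite /= -pU.
(* Extend the deformation of the boundary to one of [w] in [B]. *)
have [W [sW WE]] := box_filler (glue_near spU pU') (glue_stable spU sw pU').
have Wfar y : far (3 * M) (base y) -> p (U y) = W y.
  move=> h; rewrite WE; last by apply/(@in_box_time _ _ true); left.
  by rewrite glue_side //; apply: farW h; lia.
have sW1 := slice_stable (- (3 * M)%:Z) sW.
have [||M1 [l [sl pl lU]]] := H (3 * M)%N (slice W (- (3 * M)%:Z)) _ sW1.
- by lia.
- move=> x hx; rewrite /= -Wfar ?base_at //.
  by congr (p _); apply: (sUt _ _ _ M) => //; rewrite /clamp; lia.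
pose K := maxn (3 * M) M1.
have sUK : stable K U by apply: stableW sU; rewrite /K; lia.
have sWK : stable K W by apply: stableW sW; rewrite /K; lia.
have slK : stable K l by apply: stableW sl; rewrite /K; lia.
have sWt t t' x : clamp (3 * M) t = clamp (3 * M) t' ->
    W (at_time t x) = W (at_time t' x).
  move=> E0; rewrite -[in LHS]((stable_clamp (3 * M) W).1 sW).
  by rewrite -[in RHS]((stable_clamp (3 * M) W).1 sW) !clamp_at E0.
(* Transport the solution at the initial time to the final time. *)
have [|||M2 [l1 [sl1 pl1 lU1]]] := homotopy_lifting bp sUK sWK slK.
- by move=> y hy; apply: Wfar; apply: farW hy; rewrite /K; lia.
- by move=> x; rewrite pl /=; apply: sWt; rewrite /clamp /K; lia.
- move=> x hx; rewrite lU /=; last by apply: farW hx; rewrite /K; lia.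
  by apply: (sUt _ _ _ M) => //; rewrite /clamp /K; lia.
exists M2, l1; split=> // x.
- rewrite pl1 (sWt _ (3 * M)%:Z); last by rewrite /clamp /K; lia.
  have hf : on_face (3 * M) (ord_max, true) (at_time (3 * M)%:Z x).
    by rewrite /on_face /= -/(time _) time_at.
  rewrite WE; last by apply/(@in_box_time _ _ true); right.
  by rewrite /glue (on_faceW _ hf) ?base_at //; lia.
- by move=> /lU1 ->; apply: (sUt _ _ _ M) => //; rewrite /clamp /K; lia.
Qed.

(** Lifting the homotopy starting from [f], with the constant lift over infinity,
    ends at a lift of [g]. *)
Lemma strict_lift (E B : graph) (p : gmap E B) n (v : E) (f : bmap n v) (g : bmap n (p v)) :
  box_lifting p -> homotopic (postcomp p f) g ->
  exists f' : bmap n v, forall x, p (f' x) = g x.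
Proof.
move=> bp /homotopic_cylinder [M0 [W cW0]].
pose M := maxn M0 (bound f).
have cW : cylinder (p v) (postcomp p f) g M W by apply: cylinderW cW0; apply: leq_maxl.
have cf : const_far M v f by apply: const_farW (boundP (f := f)); apply: leq_maxr.
have cP : forall y z : Icube n.+1, near y z -> near v v by [].
pose U : gmap (Icube n.+1) E := Gmap (gfun := fun _ : Icube n.+1 => v) cP.
have sU : stable M U by apply/stable_clamp.
have [|||M' [l [sl pl lU]]] := homotopy_lifting bp sU (cylinder_stable cW) (const_far_stable cf).
- by move=> y hy; rewrite (cyl_far cW).
- by move=> x; rewrite (cyl_start cW) ?base_at // time_at.
- by move=> x hx; rewrite cf.
have cl : exists M, const_far M v l by exists M' => x /lU.
by exists (Bmap cl) => x; rewrite /= pl (cyl_end cW) ?base_at // time_at.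
Qed.

(** The contraction [y |-> (min(y_0, t), y_1, ...)] moves only one coordinate:
    contracting all of them at the same time would not be a graph map. *)
Definition squeeze n (z : 'I_n.+2 -> int) : 'I_n.+1 -> int :=
  upd (base z) ord0 (Num.min (base z ord0) (time z)).

Lemma squeeze_near n (y z : Icube n.+2) : near y z ->
  near (squeeze y : Icube n.+1) (squeeze z).
Proof.
move=> /near_base_time [[Eb /near_Iinf h]|[Et /near_pow [Eb|[k /near_Iinf h Eb]]]].
- apply: (@near_cube _ _ _ ord0) => [|j /negPf j0].
    by apply/near_Iinf; rewrite /squeeze !updE eqxx Eb; lia.
  by rewrite /squeeze !updE j0 Eb.
- by rewrite /squeeze Et Eb.
- apply: (@near_cube _ _ _ k) => [|j jk]; rewrite /squeeze !updE Et.
    by apply/near_Iinf; case: eqP => [<-|_]; lia.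
  by case: eqP => [E|_]; rewrite -?E Eb.
Qed.

Lemma clamp_squeeze n M (z : 'I_n.+2 -> int) :
  clamp M \o squeeze z = squeeze (clamp M \o z).
Proof.
apply: functional_extensionality => j; rewrite /squeeze /= !updE /time /base /delete /=.
by case: (j == ord0); rewrite /clamp; lia.
Qed.

(** As the boundary condition extends to a map [k] on the whole cube which is
    constant for [y_0 <= - M], squeezing the first coordinate deforms it to a
    constant.  The deformed problem is an element of [A_(n+1)(B)], and a strict
    lift of it exists as [A_(n+1)(p)] is surjective. *)
Lemma sphere_lift (E B : graph) (p : gmap E B) n M c
    (k : gmap (Icube n.+1) E) (w : gmap (Icube n.+1) B) :
  box_lifting p -> A_surjective n.+1 p c ->
  stable M k -> stable M w ->
  (forall y, y ord0 <= - M%:Z -> k y = c) ->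
  (forall y, far M y -> p (k y) = w y) -> solvable p k w.
Proof.
move=> bp surj sk sw kc kw.
pose U : gmap (Icube n.+2) E := gmap_comp k (Gmap (@squeeze_near n)).
have sU : stable M U.
  by apply/stable_clamp => z; rewrite /= -clamp_squeeze; have /stable_clamp -> := sk.
have Uend x : U (at_time M%:Z x) = k x.
  rewrite /= /squeeze base_at time_at -[LHS]((stable_clamp M k).1 sk).
  rewrite -[RHS]((stable_clamp M k).1 sk); congr (k _).
  apply: functional_extensionality => j; rewrite /= updE.
  by case: eqP => [->|//]; rewrite /clamp; lia.
have Ustart x : U (at_time (- M%:Z) x) = c.
  by rewrite /= /squeeze base_at time_at kc // updE eqxx; lia.
suff [M' [l [sl pl lU]]] : solvable p (slice U M%:Z) w.
  by exists M', l; split=> // x /lU ->; exact: Uend.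
apply: (solvable_deform bp sU sw) => [x hx|M' w' MM' sw' w'c].
  by rewrite Uend kw.
have cw' : exists M, const_far M (p c) w'.
  by exists M' => x hx; rewrite -w'c // Ustart.
have [f hf] := surj (Bmap cw').
have [f' pf'] := strict_lift bp hf.
exists (bound f'), f'; split=> //.
  by apply: const_far_stable; apply: boundP.
by move=> x /boundP ->; rewrite -(Ustart x).
Qed.

(** * Composition and change of base point *)

Section Composition.
Variables (X Y Z : graph) (g : gmap Y Z) (f : gmap X Y) (v : X) (n : nat).

Lemma A_bijective_comp :
  A_bijective n f v -> A_bijective n g (f v) -> A_bijective n (gmap_comp g f) v.
Proof.
move=> [fi fs] [gi gs]; split=> [a a' h|k].
  by apply: fi; apply: gi.
have [b hb] := gs k; have [a ha] := fs b; exists a.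
exact: homotopic_trans (homotopic_postcomp g ha) hb.
Qed.

Lemma A_bijective_cancelr :
  A_bijective n f v -> A_bijective n (gmap_comp g f) v -> A_bijective n g (f v).
Proof.
move=> [fi fs] [gfi gfs]; split=> [b b' hb|k].
  have [a ha] := fs b; have [a' ha'] := fs b'.
  apply: homotopic_trans (homotopic_sym ha) _; apply: homotopic_trans (ha').
  apply: homotopic_postcomp; apply: gfi.
  apply: homotopic_trans (homotopic_postcomp g ha) _; apply: homotopic_trans hb _.
  exact: homotopic_sym (homotopic_postcomp g ha').
by have [a ha] := gfs k; exists (postcomp f a).
Qed.

Lemma A_bijective_cancell :
  A_bijective n g (f v) -> A_bijective n (gmap_comp g f) v -> A_bijective n f v.
Proof.
move=> [gi gs] [gfi gfs]; split=> [a a' h|b].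
  by apply: gfi; apply: (homotopic_postcomp g h).
by have [a ha] := gfs (postcomp g b); exists a; apply: gi.
Qed.
End Composition.

Section BasePoint.
Variables (n : nat) (G : graph).

Definition farb (M : nat) (x : 'I_n -> int) := [exists i, (M <= absz (x i))%N].

Lemma farbP M x : reflect (far M x) (farb M x).
Proof. exact: existsP. Qed.

Lemma far_step M (x y : Icube n) : near x y -> far M.+1 y -> far M x.
Proof.
by move=> xy [i hi]; exists i; have /near_Iinf := near_coord i xy; lia.
Qed.

(** Transport along an edge replaces the value at infinity by the adjacent one;
    one more layer at the old value makes room for the change. *)
Lemma retag_near (v w : G) M (f : gmap (Icube n) G) : near v w -> const_far M v f ->
  forall x y : Icube n, near x y ->
    near (if farb M.+1 x then w else f x) (if farb M.+1 y then w else f y).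
Proof.
move=> vw cf x y xy.
case: farbP => hx; case: farbP => hy //; last exact: gfunP.
  by apply: near_sym; rewrite cf //; apply: far_step hx; apply: near_sym.
by rewrite cf //; apply: far_step hy.
Qed.

Lemma retag_far (w : G) M (f : gmap (Icube n) G) :
  const_far M.+1 w (fun x => if farb M.+1 x then w else f x).
Proof. by move=> x /farbP ->. Qed.

Definition retag (v w : G) M (f : gmap (Icube n) G) vw (cf : const_far M v f) : bmap n w :=
  Bmap (bfun := Gmap (retag_near vw cf))
    (ex_intro (fun M => const_far M w _) _ (@retag_far w M f)).

Lemma retag_adj (v w : G) M (f : bmap n v) (vw : near v w) (cf : const_far M v f) x :
  near (f x) (retag vw cf x).
Proof.
by rewrite /=; case: farbP => // hx; rewrite cf //; apply: farW hx.
Qed.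

(** Being pointwise adjacent relates based maps to their transports.  As this is
    symmetric in the two base points, the lemma covers the transport along an
    edge and along its reverse, which is the inverse up to homotopy. *)
Lemma homotopic_near (v w : G) (f g : bmap n v) (f' g' : bmap n w) : near v w ->
  (forall x, near (f x) (f' x)) -> (forall x, near (g x) (g' x)) ->
  homotopic f g -> homotopic f' g'.
Proof.
move=> vw ff' gg' /homotopic_cylinder [M0 [k ck0]].
pose M := maxn M0 (maxn (maxn (bound f) (bound g)) (maxn (bound f') (bound g'))).
have ck : cylinder v f g M k by apply: cylinderW ck0; rewrite /M; lia.
have cf : const_far M v f by apply: const_farW (boundP (f := f)); rewrite /M; lia.
have cg : const_far M v g by apply: const_farW (boundP (f := g)); rewrite /M; lia.
have cf' : const_far M.+1 w f' by apply: const_farW (boundP (f := f')); rewrite /M; lia.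
have cg' : const_far M.+1 w g' by apply: const_farW (boundP (f := g')); rewrite /M; lia.
apply: (@homotopic_trans _ _ _ _ (retag vw cf)).
  apply: homotopic_step => x /=; case: farbP => hx; first by rewrite cf'.
  exact: near_sym.
apply: (@homotopic_trans _ _ _ _ (retag vw cg)); last first.
  by apply: homotopic_step => x /=; case: farbP => hx //; rewrite cg'.
have hP (y z : Icube n.+1) : near y z ->
    near (if farb M.+1 (base y) then w else k y) (if farb M.+1 (base z) then w else k z).
  move=> yz; have [[E _]|[E h]] := near_base_time yz.
    by rewrite E; case: ifP => _ //; apply: gfunP.
  have cs : const_far M v (slice k (time z)).
    by move=> x hx; rewrite /= (cyl_far ck) // base_at.
  by have := retag_near vw cs h; rewrite /= -{1}E !at_base.
apply: (@cylinder_homotopic _ _ _ _ _ M.+1 (Gmap hP)); split=> y hy /=.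
- by rewrite (cyl_start ck) //; lia.
- by rewrite (cyl_end ck) //; lia.
- by case: farbP.
Qed.
End BasePoint.

Lemma change_base n (G H : graph) (p : gmap G H) (v w : G) : near v w ->
  A_bijective n p v -> A_bijective n p w.
Proof.
move=> vw [inj surj]; have wv := near_sym vw.
split=> [f g fg|k].
  pose f0 := retag wv (boundP (f := f)); pose g0 := retag wv (boundP (f := g)).
  apply: (@homotopic_near _ _ v w f0 g0) => // [x|x|].
  - exact/near_sym/retag_adj.
  - exact/near_sym/retag_adj.
  apply: inj; apply: (homotopic_near (gfunP p wv)) fg => x; apply: (gfunP p); exact: retag_adj.
pose k0 := retag (gfunP p wv) (boundP (f := k)).
have [f hf] := surj k0; exists (retag vw (boundP (f := f))).
apply: (homotopic_near (gfunP p vw)) hf => x.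
  by apply: (gfunP p); apply: retag_adj.
exact/near_sym/retag_adj.
Qed.

Lemma const_far0 (G : graph) (v w : G) : exists M, const_far M v (fun _ : Icube 0 => w).
Proof. by exists 0%N => x [[]]. Qed.

(** In dimension 0 there is nothing at infinity, so that any vertex [w] is a
    based map for any base point [v]. *)
Definition point (G : graph) (v w : G) : bmap 0 v :=
  Bmap (bfun := Gmap (gfun := fun _ : Icube 0 => w) (fun _ _ _ => near_refl w))
    (const_far0 v w).

Lemma change_base_path n (G H : graph) (p : gmap G H) (v w : G) (u : G) :
  homotopic (point u v) (point u w) ->
  A_bijective n p v -> A_bijective n p w.
Proof.
case=> m [eta [e0 e1 _]] hv; pose x : Icube 0 := fun _ => 0.
have E (j : nat) : (j <= m)%N ->
    A_bijective n p (eta (x, inord j)).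
  elim: j => [|j IH] hj.
    by rewrite (_ : inord 0 = ord0) ?e0 //; apply: val_inj; rewrite /= inordK.
  apply: change_base (IH (ltnW hj)); apply: gmap_prodr; apply/Ifin_near.
  by rewrite !inordK //; [constructor 2|lia].
have := E m (leqnn m); rewrite (_ : inord m = ord_max) ?e1 //.
by apply: val_inj; rewrite /= inordK.
Qed.

(** If [f] and [g f] are weak equivalences, [g] is controlled at the vertices
    [f v] only.  Every other vertex is connected to one of these, since [f] is
    surjective on components. *)
Lemma weq_two_out_of_three : two_out_of_three (C := graph_cat) weak_homotopy_equiv.
Proof.
move=> X Y Z g f; split=> [/weqP [f1 f2] /weqP [g1 g2]|/weqP [f1 f2] /weqP [h1 h2]|
  /weqP [g1 g2] /weqP [h1 h2]]; apply/weqP.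
- by split=> [v n|/g2/f2//]; apply: A_bijective_comp.
- split=> [w n|/h2 [v]]; last exact: inhabits (gfun f v).
  have [v] := f2 (inhabits w).
  have [_ fs] := f1 v 0%N; have [a ha] := fs (point (f v) w).
  have hv : homotopic (point (f v) (f (a (fun=> 0)))) (point (f v) w).
    apply: homotopic_trans ha; apply: homotopic_ext => x /=; congr (f (a _)).
    exact: pow_graph0.
  by apply: change_base_path hv _; apply: A_bijective_cancelr.
- by split=> [v n|[y]]; [apply: (A_bijective_cancell (g := g))|exact: h2 (inhabits (gfun g y))].
Qed.

Lemma weq_id (X : graph) : weak_homotopy_equiv (gmap_id X).
Proof.
apply/weqP; split=> // v n; split=> [f g //|g]; exists g; exact: homotopic_ext.
Qed.

(** * Fibrations and pullbacks *)

Lemma fibration_iso (X Y : graph) (f : gmap X Y) :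
  is_iso (C := graph_cat) f -> box_lifting f.
Proof.
case=> g [gf fg] n i e M u w sw nu su pu.
have gK x : g (f x) = x := congr1 (fun h : gmap X X => h x) gf.
have fK y : f (g y) = y := congr1 (fun h : gmap Y Y => h y) fg.
exists M, (gmap_comp g w); split=> //; first exact: (stable_comp g sw).
  by move=> x; apply: fK.
by move=> x /pu /= <-; apply: gK.
Qed.

Lemma fibration_comp (X Y Z : graph) (g : gmap Y Z) (f : gmap X Y) :
  box_lifting g -> box_lifting f -> box_lifting (gmap_comp g f).
Proof.
move=> bg bf n i e M u w sw nu su pu.
have [||M1 [l1 [MM1 sl1 gl1 l1u]]] := bg n i e M (fun x => f (u x)) w sw _ _ pu.
- by move=> x y hx hy xy; apply: gfunP; apply: nu.
- by move=> x hx; rewrite su.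
have [|M2 [l2 [M12 sl2 fl2 l2u]]] :=
    bf n i e M1 u l1 sl1 (near_onW MM1 nu) (stable_onW MM1 su).
  by move=> x hx; rewrite l1u.
exists M2, l2; split=> //; first exact: leq_trans M12.
by move=> x; rewrite /= fl2 gl1.
Qed.

Definition unit_graph : graph.
Proof. by refine (@Graph unit (fun _ _ => False) _ _) => // v; case. Defined.

Definition to_unit (G : graph) : gmap G unit_graph :=
  @Gmap G unit_graph (fun _ => tt) (fun _ _ _ => near_refl _).

Lemma fibration_unit (X : graph) (f : gmap X unit_graph) : box_lifting f.
Proof.
move=> n i e M u w sw nu su pu; have [l [sl lu]] := box_filler nu su.
exists (3 * M)%N, l; split=> //; first by lia.
by move=> x; case: (f _); case: (w _).
Qed.

Definition vertex_map (G : graph) (v : G) : gmap unit_graph G :=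
  @Gmap unit_graph G (fun _ => v) (fun _ _ _ => near_refl v).

Section Pullback.
Variables (P A E B : graph) (q : gmap P A) (g : gmap P E) (f : gmap A B) (p : gmap E B).
Hypothesis pb : is_pullback (C := graph_cat) q g f p.

Lemma pullback_commute x : f (q x) = p (g x).
Proof. exact: (congr1 (fun h : gmap P B => h x) pb.1). Qed.

Lemma pullback_inj x y : q x = q y -> g x = g y -> x = y.
Proof.
move=> qxy gxy.
have [|u [_ uu]] := pb.2 unit_graph (vertex_map (q x)) (vertex_map (g x)).
  by apply: gmap_eq => t /=; apply: pullback_commute.
have hx : u = vertex_map x by apply: uu; split; apply: gmap_eq.
have hy : u = vertex_map y by apply: uu; split; apply: gmap_eq => t; rewrite /= ?qxy ?gxy.
exact: (congr1 (fun h : gmap unit_graph P => h tt) (etrans (esym hx) hy)).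
Qed.

Lemma pullback_map (X : graph) (a : gmap X A) (e : gmap X E) :
  (forall x, f (a x) = p (e x)) ->
  exists u : gmap X P, (forall x, q (u x) = a x) /\ forall x, g (u x) = e x.
Proof.
move=> h; have [|u [[qu gu] _]] := pb.2 X a e; first exact: gmap_eq.
exists u; split=> x.
  exact: (congr1 (fun h : gmap X A => h x) qu).
exact: (congr1 (fun h : gmap X E => h x) gu).
Qed.

Lemma fibration_pullback : box_lifting p -> box_lifting q.
Proof.
move=> bp n i e M u w sw nu su pu.
have [||||M' [l [MM' sl pl lu]]] := bp n i e M (fun x => g (u x)) (gmap_comp f w).
- exact: (stable_comp f sw).
- by move=> x y hx hy xy; apply: gfunP; apply: nu.
- by move=> x hx; rewrite su.
- by move=> x hx; rewrite -pullback_commute pu.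
have [v [qv gv]] : exists v : gmap (Icube n.+1) P,
    (forall x, q (v x) = w x) /\ forall x, g (v x) = l x.
  by apply: pullback_map => x; rewrite pl.
exists M', v; split=> // [|x hx].
  apply/stable_clamp => x; apply: pullback_inj; rewrite ?qv ?gv.
    by apply/(stable_clamp M' w): x; apply: stableW sw.
  by apply/(stable_clamp M' l): x.
have hxM : in_box i e M x by apply: in_boxW hx.
by apply: pullback_inj; rewrite ?qv ?gv ?pu ?lu.
Qed.

Hypotheses (bp : box_lifting p) (wp : weak_homotopy_equiv p).

(** A map to [A] is sent to [B], lifted to [E] up to homotopy, and then strictly;
    together with the given map this is a map to the pullback. *)
Lemma pullback_A_surjective n v : A_surjective n q v.
Proof.
move=> a; have [hp _] := (weqP p).1 wp; have [_ surj] := hp (g v) n.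
have cb : exists M, const_far M (p (g v)) (gmap_comp f a).
  by exists (bound a) => x /boundP /= ->; rewrite pullback_commute.
have [e0 he0] := surj (Bmap cb).
have [e pe] := strict_lift bp he0.
have [u [qu gu]] : exists u : gmap (Icube n) P,
    (forall x, q (u x) = a x) /\ forall x, g (u x) = e x.
  by apply: pullback_map => x; rewrite pe.
have cu : exists M, const_far M v u.
  exists (maxn (bound a) (bound e)) => x hx.
  apply: pullback_inj; rewrite ?qu ?gu; apply: boundP; apply: farW hx.
    exact: leq_maxl.
  exact: leq_maxr.
by exists (Bmap cu); apply: homotopic_ext.
Qed.

(** A homotopy in [A] and one in [E] between the same maps need not agree in
    [B]; the second one is corrected to lie over the first. *)
Lemma pullback_A_injective n v : A_injective n q v.
Proof.
move=> a b /homotopic_cylinder [M0 [F cF0]].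
have [hp _] := (weqP p).1 wp; have [inj _] := hp (g v) n.
have /inj : homotopic (postcomp p (postcomp g a)) (postcomp p (postcomp g b)).
  apply: (@cylinder_homotopic _ _ _ _ _ M0 (gmap_comp f F)); split=> y hy /=.
  - by rewrite (cyl_start cF0) //= pullback_commute.
  - by rewrite (cyl_end cF0) //= pullback_commute.
  - by rewrite (cyl_far cF0) //= pullback_commute.
move=> /homotopic_cylinder [M1 [K cK1]].
pose M := maxn M0 M1.
have cF : cylinder (q v) (postcomp q a) (postcomp q b) M F.
  by apply: cylinderW cF0; apply: leq_maxl.
have cK : cylinder (g v) (postcomp g a) (postcomp g b) M K.
  by apply: cylinderW cK1; apply: leq_maxr.
have Kf y : far M y -> p (K y) = f (F y).
  case=> i hi; case: (unliftP ord_max i) hi => [j|] -> hi.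
    have hy : far M (base y) by exists j.
    by rewrite (cyl_far cK) // (cyl_far cF) // pullback_commute.
  have [hy|hy] : time y <= - M%:Z \/ M%:Z <= time y by rewrite /time; lia.
    by rewrite (cyl_start cK) // (cyl_start cF) //= pullback_commute.
  by rewrite (cyl_end cK) // (cyl_end cF) //= pullback_commute.
(* The face [y_0 = - M] is at infinity if [n > 0].  For [n = 0] it is the start
   of the path [K]. *)
have [c Kc] : exists c, forall y, y ord0 <= - M%:Z -> K y = c.
  case: n a b F cF0 inj K cK1 cF cK {Kf} => [|n] a b F _ _ K _ _ cK.
    exists (g (a (fun=> 0))) => y hy; rewrite (cyl_start cK) /=.
      by congr (g (a _)); apply: pow_graph0.
    by rewrite /time (_ : ord_max = ord0) //; apply: val_inj.
  exists (g v) => y hy; rewrite (cyl_far cK) //; exists ord0.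
  by rewrite /base /delete (_ : lift _ _ = ord0); [lia|apply: val_inj].
have sK := cylinder_stable cK; have sF := cylinder_stable cF.
have sfF : stable M (gmap_comp f F) by apply: (stable_comp f sF).
have [M2 [l [sl pl lK]]] := sphere_lift bp (hp c n.+1).2 sK sfF Kc Kf.
have [u [qu gu]] : exists u : gmap (Icube n.+1) P,
    (forall x, q (u x) = F x) /\ forall x, g (u x) = l x.
  by apply: pullback_map => x; rewrite pl.
pose M' := maxn M M2.
have cF' : cylinder (q v) (postcomp q a) (postcomp q b) M' F.
  by apply: cylinderW cF; apply: leq_maxl.
have cK' : cylinder (g v) (postcomp g a) (postcomp g b) M' K.
  by apply: cylinderW cK; apply: leq_maxl.
apply: (@cylinder_homotopic _ _ _ _ _ M' u); split=> y hy; apply: pullback_inj.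
- by rewrite qu (cyl_start cF').
- rewrite gu lK ?(cyl_start cK') //; exists ord_max; move: hy; rewrite /time /M'; lia.
- by rewrite qu (cyl_end cF').
- rewrite gu lK ?(cyl_end cK') //; exists ord_max; move: hy; rewrite /time /M'; lia.
- by rewrite qu (cyl_far cF').
- rewrite gu lK ?(cyl_far cK') //; case: hy => j hj; exists (lift ord_max j).
  by move: hj; rewrite /base /delete /M'; lia.
Qed.

Lemma pullback_inhabited : inhabited A -> inhabited P.
Proof.
case=> a; have [hp hi] := (weqP p).1 wp.
have [e0] := hi (inhabits (f a)).
have [_ surj] := hp e0 0%N; have [z hz] := surj (point (p e0) (f a)).
have [e pe] := strict_lift bp hz.
have [u _] : exists u : gmap unit_graph P,
    (forall x, q (u x) = vertex_map a x) /\
    forall x, g (u x) = vertex_map (e (fun=> 0)) x.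
  by apply: pullback_map => x; rewrite /= pe.
by exists; apply: (u tt).
Qed.

Lemma weq_pullback : weak_homotopy_equiv q.
Proof.
apply/weqP; split=> [v n|]; last exact: pullback_inhabited.
by split; [exact: pullback_A_injective|exact: pullback_A_surjective].
Qed.
End Pullback.

Section PullbackGraph.
Variables (A E B : graph) (f : gmap A B) (p : gmap E B).

(** Adjacency in the pullback is coordinatewise: this is the categorical
    product, in contrast to [prod_graph]. *)
Definition pullback_graph : graph.
Proof.
refine (@Graph {x : A * E | f x.1 = p x.2}
  (fun x y => [/\ x <> y, near (sval x).1 (sval y).1 & near (sval x).2 (sval y).2]) _ _).
- by move=> x y [ne h1 h2]; split; [move=> /esym|apply: near_sym|apply: near_sym].
- by move=> x [].
Defined.

Lemma near_pullback (x y : pullback_graph) :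
  near x y <-> near (sval x).1 (sval y).1 /\ near (sval x).2 (sval y).2.
Proof.
split=> [[->//|[]//]|[h1 h2]].
by case: (excluded_middle_informative (x = y)) => [|ne]; [left|right].
Qed.

Lemma pullback_graph_eq (x y : pullback_graph) : sval x = sval y -> x = y.
Proof. by move=> h; apply: eq_sig_hprop => // *; apply: proof_irrelevance. Qed.

Definition pullback_fst : gmap pullback_graph A :=
  @Gmap pullback_graph A (fun x => (sval x).1) (fun x y h => ((near_pullback x y).1 h).1).

Definition pullback_snd : gmap pullback_graph E :=
  @Gmap pullback_graph E (fun x => (sval x).2) (fun x y h => ((near_pullback x y).1 h).2).

Lemma pullback_graphP :
  is_pullback (C := graph_cat) pullback_fst pullback_snd f p.
Proof.
split=> [|X a e ae]; first by apply: gmap_eq => x; apply: (svalP x).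
have aeE x : f (a x) = p (e x) := congr1 (fun h : gmap X B => h x) ae.
pose u x : pullback_graph := exist _ (a x, e x) (aeE x).
have uP x y : near x y -> near (u x) (u y).
  by move=> xy; apply/near_pullback; split; apply: gfunP.
exists (Gmap uP); split; first by split; apply: gmap_eq.
move=> u' [/= qu gu]; apply: gmap_eq => x; apply: pullback_graph_eq => /=.
have := congr1 (fun h : gmap X A => h x) qu; have := congr1 (fun h : gmap X E => h x) gu.
by move=> /= <- <-; case: (sval (u' x)).
Qed.
End PullbackGraph.

(** * Path objects and factorization *)

(** Stable maps have only finitely many values. *)
Lemma cube_bound n (P : ('I_n -> int) -> nat -> Prop) M :
  (forall x T T', (T <= T')%N -> P x T -> P x T') ->
  (forall x, exists T, P x T) -> exists T, forall x, P (clamp M \o x) T.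
Proof.
move=> mono ex.
pose pt (c : {ffun 'I_n -> 'I_(2 * M).+1}) : 'I_n -> int := fun j => (c j)%:Z - M%:Z.
have [|c|T hT] := @fin_bound {ffun 'I_n -> 'I_(2 * M).+1} (fun c => P (pt c)).
- by move=> c; apply: mono.
- exact: ex.
exists T => x; have := hT [ffun j => inord (absz (clamp M (x j) + M%:Z))].
congr (P _ T); apply: functional_extensionality => j.
by rewrite /pt ffunE /= inordK /clamp; lia.
Qed.

Section MappingPath.
Variables (X Y : graph) (f : gmap X Y).

Definition path_bound (M : nat) (z : X * (int -> Y) * Y) :=
  forall t, (t <= - M%:Z -> z.1.2 t = f z.1.1) /\ (M%:Z <= t -> z.1.2 t = z.2).

(** The end of the path is part of the data, as reading it off from the path
    would require the choice of a bound. *)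
Definition mpath := {z : X * (int -> Y) * Y |
  (forall t, near (z.1.2 t) (z.1.2 (t + 1))) /\ exists M, path_bound M z}.

Definition mstart (z : mpath) : X := (sval z).1.1.
Definition mpt (z : mpath) : int -> Y := (sval z).1.2.
Definition mstop (z : mpath) : Y := (sval z).2.

Lemma mpath_eq z z' : mstart z = mstart z' -> (forall t, mpt z t = mpt z' t) ->
  mstop z = mstop z' -> z = z'.
Proof.
move=> h1 /functional_extensionality h2 h3; apply: eq_sig_hprop => [*|].
  exact: proof_irrelevance.
case: z z' h1 h2 h3 => [[[x g] y] hz] [[[x' g'] y'] hz'].
by rewrite /mstart /mpt /mstop /= => -> -> ->.
Qed.

(** Paths are adjacent if they are so pointwise: maps from [I^n] to paths in [Y]
    are then maps from [I^(n+1)] to [Y]. *)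
Definition mpath_graph : graph.
Proof.
refine (@Graph mpath (fun z z' => [/\ z <> z', near (mstart z) (mstart z'),
  forall t, near (mpt z t) (mpt z' t) & near (mstop z) (mstop z')]) _ _).
- move=> z z' [ne h1 h2 h3]; split; [by move=> /esym|exact: near_sym| |exact: near_sym].
  by move=> t; apply: near_sym.
- by move=> z [].
Defined.

Lemma near_mpath (z z' : mpath_graph) : near z z' <->
  [/\ near (mstart z) (mstart z'), forall t, near (mpt z t) (mpt z' t) &
      near (mstop z) (mstop z')].
Proof.
split=> [[->//|[]//]|[h1 h2 h3]].
by case: (excluded_middle_informative (z = z')) => [|ne]; [left|right].
Qed.

Definition mstart_map : gmap mpath_graph X.
Proof. by refine (@Gmap mpath_graph X mstart _) => z z' /near_mpath []. Defined.

Definition mstop_map : gmap mpath_graph Y.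
Proof. by refine (@Gmap mpath_graph Y mstop _) => z z' /near_mpath []. Defined.

Lemma mpt_near (z : mpath) t : near (mpt z t) (mpt z (t + 1)).
Proof. exact: (proj2_sig z).1. Qed.

Lemma mpath_bounded (z : mpath) : exists M, path_bound M (sval z).
Proof. exact: (proj2_sig z).2. Qed.

Lemma path_boundW M M' z : (M <= M')%N -> path_bound M z -> path_bound M' z.
Proof. by move=> h b t; have [b0 b1] := b t; split=> ?; [apply: b0|apply: b1]; lia. Qed.

Definition const_path (x : X) : mpath.
Proof.
refine (exist _ (x, fun _ => f x, f x) _); split=> //.
by exists 0%N => t; split.
Defined.

Definition const_path_map : gmap X mpath_graph.
Proof.
refine (@Gmap X mpath_graph const_path _) => x x' h; apply/near_mpath.
by split=> [//|t|]; apply: gfunP.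
Defined.

Definition truncate (s : int) (z : mpath) : mpath.
Proof.
refine (exist _ (mstart z, fun t => mpt z (Num.min t s), mpt z s) _); split=> [t|] /=.
  apply: (near_int (h := mpt z) (@mpt_near z)); apply/near_Iinf; lia.
have [M bM] := mpath_bounded z; exists (M + absz s)%N => t; split=> /= h.
  by rewrite (_ : Num.min t s = t); [apply: (bM t).1|]; lia.
by congr mpt; lia.
Defined.

Lemma truncate_near s (z z' : mpath_graph) : near z z' ->
  near (truncate s z : mpath_graph) (truncate s z').
Proof.
by move=> /near_mpath [h1 h2 h3]; apply/near_mpath; split=> [|t|]; [exact: h1|exact: h2|exact: h2].
Qed.

Lemma truncate_step s (z : mpath_graph) :
  near (truncate s z : mpath_graph) (truncate (s + 1) z).
Proof.
have nz := near_int (h := mpt z) (@mpt_near z).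
apply/near_mpath; split=> [//|t|].
  by apply: nz; apply/near_Iinf; lia.
exact: mpt_near.
Qed.

Lemma truncate_const s x : truncate s (const_path x) = const_path x.
Proof. exact: mpath_eq. Qed.

Lemma truncate_start M s z : path_bound M (sval z) -> s <= - M%:Z ->
  truncate s z = const_path (mstart z).
Proof.
move=> b h; have E t : t <= s -> mpt z t = f (mstart z).
  by move=> ts; apply: (b t).1; lia.
by apply: mpath_eq => //= [t|]; apply: E; lia.
Qed.

Lemma truncate_end M s z : path_bound M (sval z) -> M%:Z <= s -> truncate s z = z.
Proof.
move=> b h; have E t : M%:Z <= t -> mpt z t = mstop z by move=> ts; apply: (b t).2.
apply: mpath_eq => //= [t|]; last exact: E.
rewrite /mpt /= -/(mpt z); case: (leP t s) => // ts.
by rewrite !E //; lia.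
Qed.

(** The constant paths are a deformation retract: paths are shrunk to their
    starting point by truncation. *)
Lemma const_path_weq : weak_homotopy_equiv const_path_map.
Proof.
apply/weqP; split=> [v n|[z]]; last by exists; apply: mstart z.
split=> [a b /(homotopic_postcomp mstart_map)//|k].
have ca : exists M, const_far M v (gmap_comp mstart_map k).
  by exists (bound k) => x /boundP /= ->.
exists (Bmap ca).
have [T hT] : exists T, forall x, path_bound T (sval (k (clamp (bound k) \o x))).
  apply: (@cube_bound _ (fun x T => path_bound T (sval (k x)))) => x.
    by move=> T T'; apply: path_boundW.
  exact: mpath_bounded.
have sk := (stable_clamp (bound k) k).1 (const_far_stable (boundP (f := k))).
pose M := maxn T (bound k).
have bM x : path_bound M (sval (k x)).
  by rewrite -sk; apply: path_boundW (hT x); apply: leq_maxl.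
pose h (x : 'I_n -> int) (t : int) : mpath_graph := truncate t (k x).
have hx (x y : Icube n) t : near x y -> near (h x t) (h y t).
  by move=> xy; apply: truncate_near; apply: gfunP.
have ht x t : near (h x t) (h x (t + 1)) := truncate_step t (k x).
apply: (@cylinder_homotopic _ _ _ _ _ M (cylinder_map hx ht)); split=> y hy /=.
- exact: truncate_start hy.
- exact: truncate_end hy.
- by rewrite /h boundP ?truncate_const //; apply: farW hy; apply: leq_maxr.
Qed.

Lemma in_box_lift n (i : 'I_n.+1) e M (y : 'I_n.+2 -> int) :
  in_box i e M (base y) -> in_box (lift ord_max i) e M y.
Proof.
case=> -[j d] ne h; exists (lift ord_max j, d) => //.
by move: ne; rewrite !xpair_eqE (inj_eq lift_inj).
Qed.

(** The starting points form an open box in [X], which is filled first.  The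
    paths then form an open box of one dimension more in [Y]: the two additional
    faces are the images of the filler and the prescribed end points. *)
Lemma mstop_fibration : box_lifting mstop_map.
Proof.
move=> n i e M u w sw nu su pu.
have [lx [slx lxu]] : exists l : gmap (Icube n.+1) X, stable (3 * M) l /\
    forall x, in_box i e (3 * M) x -> l x = mstart (u x).
  apply: box_filler => [x y hx hy xy|x hx]; last by rewrite su.
  exact: (gfunP mstart_map (nu _ _ hx hy xy)).
have [T0 hT] : exists T, forall x, path_bound T (sval (u (clamp M \o x))).
  apply: (@cube_bound _ (fun x T => path_bound T (sval (u x)))) => x.
    by move=> T T'; apply: path_boundW.
  exact: mpath_bounded.
(* Beyond the filler in [X] and all the paths; positive, for opposite faces to be
   disjoint. *)
pose M2 := (maxn (3 * M) T0).+1.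
have sub x : in_box i e M2 x -> in_box i e M x by apply: in_boxW; rewrite /M2; lia.
have sub3 x : in_box i e M2 x -> in_box i e (3 * M) x by apply: in_boxW; rewrite /M2; lia.
have bu x : in_box i e M2 x -> path_bound M2 (sval (u x)).
  by move=> hx; rewrite -su; [apply: path_boundW (hT x); rewrite /M2; lia|exact: sub].
have su2 : stable_on (in_box i e M2) M2 u by apply: stable_onW su; rewrite /M2; lia.
have slx2 : forall x, lx (clamp M2 \o x) = lx x.
  by apply/stable_clamp; apply: stableW slx; rewrite /M2; lia.
have sw2 : forall x, w (clamp M2 \o x) = w x.
  by apply/stable_clamp; apply: stableW sw; rewrite /M2; lia.
pose U (y : 'I_n.+2 -> int) : Y :=
  if time y <= - M2%:Z then f (lx (base y))
  else if M2%:Z <= time y then w (base y) else mpt (u (base y)) (time y).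
have Ubase y : in_box i e M2 (base y) -> U y = mpt (u (base y)) (time y).
  move=> hy; have [b0 b1] := bu _ hy (time y); rewrite /U.
  case: ifP => [/b0|_]; first by rewrite lxu //; apply: sub3.
  by case: ifP => // /b1; rewrite -pu //; apply: sub.
pose R := in_box (lift ord_max i) e M2.
have Rcase y jd : jd != (lift ord_max i, e) -> on_face M2 jd y ->
    in_box i e M2 (base y) \/ jd.1 = ord_max.
  case: jd => j d; case: (unliftP ord_max j) => [k|] ->; last by right.
  by rewrite xpair_eqE (inj_eq lift_inj) => ne h; left; exists (k, d).
have nU : near_on R U.
  move=> y z Ry Rz yz; have M20 : (0 < M2)%N by [].
  have [[j d] ne /andP [hy hz]] := near_common_face M20 Ry Rz yz.
  have [E|ej] := eqVneq j ord_max; last first.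
    have [by1|/= E] := Rcase y _ ne hy; last by rewrite E eqxx in ej.
    have [bz1|/= E] := Rcase z _ ne hz; last by rewrite E eqxx in ej.
    rewrite !Ubase //; case: (near_base_time yz) => [[-> h]|[-> h]].
      exact: (near_int (h := mpt (u (base z))) (@mpt_near _)).
    by have /near_mpath [_ + _] := nu _ _ (sub _ by1) (sub _ bz1) h; apply.
  have nb : near (base y : Icube n.+1) (base z).
    by case: (near_base_time yz) => [[->]|[]].
  subst j; rewrite /U; case: d {ne} hy hz; rewrite /on_face /= -!/(time _) => hy hz.
    by rewrite hy hz !ifF; [apply: gfunP|lia|lia].
  by rewrite hy hz; apply: gfunP; apply: gfunP.
have sU : stable_on R M2 U.
  move=> y [jd ne hy]; have [b1|E] := Rcase y _ ne hy.
    rewrite !Ubase ?clamp_base //; last exact: in_box_clamp.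
    rewrite su2 //.
    have before t : t <= - M2%:Z -> mpt (u (base y)) t = f (mstart (u (base y))).
      exact: (bu _ b1 t).1.
    have after t : M2%:Z <= t -> mpt (u (base y)) t = mstop (u (base y)).
      exact: (bu _ b1 t).2.
    have Et : time (clamp M2 \o y) = clamp M2 (time y) by [].
    rewrite Et /clamp; have [h|h] := leP M2%:Z (time y).
      by rewrite !after //; lia.
    have [h'|h'] := leP (time y) (- M2%:Z); first by rewrite !before //; lia.
    by congr mpt; lia.
  case: jd E ne hy => [j d] /= -> _; rewrite /on_face /= -/(time y) => hy.
  have Et : time (clamp M2 \o y) = clamp M2 (time y) by [].
  rewrite /U Et clamp_base slx2 sw2 /clamp.
  by case: d hy => hy; do 4 ?[case: ifP => ?] => //; lia.
have [l [sl lU]] := box_filler nU sU.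
pose K := (3 * M2)%N.
have R_time t x : (t <= - K%:Z) || (K%:Z <= t) -> in_box (lift ord_max i) e K (at_time t x).
  case/orP => h; [exists (ord_max, false)|exists (ord_max, true)];
    by rewrite ?xpair_eqE ?(negPf (neq_lift _ _)) // /on_face /= -/(time _) time_at.
have lstart t x : t <= - K%:Z -> l (at_time t x) = f (lx x).
  move=> h; rewrite lU; last by apply: R_time; rewrite h.
  by rewrite /U time_at base_at ifT //; rewrite /K in h; lia.
have lstop t x : K%:Z <= t -> l (at_time t x) = w x.
  move=> h; rewrite lU; last by apply: R_time; rewrite h orbT.
  by rewrite /U time_at base_at ifF ?ifT //; rewrite /K in h; lia.
have Lpath x : (forall t, near (l (at_time t x)) (l (at_time (t + 1) x))) /\
    exists M, path_bound M (lx x, fun t => l (at_time t x), w x).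
  split=> [t|]; first by apply: gfunP; apply: near_at_time; apply/near_Iinf; lia.
  by exists K => t; split=> h; [apply: lstart|apply: lstop].
pose L x : mpath_graph := exist _ (lx x, fun t => l (at_time t x), w x) (Lpath x).
have LP (x y : Icube n.+1) : near x y -> near (L x) (L y).
  by move=> xy; apply/near_mpath; split=> [|t|]; apply: gfunP => //; apply: near_at.
exists K, (Gmap LP); split=> // [|  |x hx].
- by rewrite /K /M2; lia.
- apply/stable_clamp => x; apply: mpath_eq => [|t|].
  + by rewrite /mstart /=; apply/(stable_clamp K lx): x; apply: stableW slx; rewrite /K /M2; lia.
  + by rewrite /mpt /=; apply: ((stable_clamp K (slice l t)).1 (slice_stable t sl) x).
  + by rewrite /mstop /=; apply/(stable_clamp K w): x; apply: stableW sw; rewrite /K /M2; lia.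
- have hx2 : in_box i e M2 x by apply: in_boxW hx; rewrite /K; lia.
  apply: mpath_eq => [|t|].
  + by apply: lxu; apply: sub3.
  + rewrite /mpt /= lU; last by apply: in_box_lift; rewrite base_at.
    by rewrite Ubase base_at // time_at.
  + exact: (esym (pu _ (sub _ hx2))).
Qed.
End MappingPath.

(** * The fibration category *)

Lemma weq_iso (X Y : graph) (f : gmap X Y) :
  is_iso (C := graph_cat) f -> weak_homotopy_equiv f.
Proof.
case=> g [gf fg].
have gK x : g (f x) = x := congr1 (fun h : gmap X X => h x) gf.
have fK y : f (g y) = y := congr1 (fun h : gmap Y Y => h y) fg.
apply/weqP; split=> [v n|[y]]; last exact: inhabits (g y).
split=> [a b /homotopic_cylinder [M [k [k0 k1 kf]]]|b].
  apply: (@cylinder_homotopic _ _ _ _ _ M (gmap_comp g k)); split=> y hy /=.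
  - by rewrite k0 //= gK.
  - by rewrite k1 //= gK.
  - by rewrite kf //= gK.
have ca : exists M, const_far M v (gmap_comp g b).
  by exists (bound b) => x /boundP /= ->.
by exists (Bmap ca); apply: homotopic_ext => x; apply: fK.
Qed.

Theorem theorem5p9 :
  fibration_category (C := graph_cat) nerve_fibration weak_homotopy_equiv.
Proof.
split.
- split=> [X|X Y Z g f /nerve_fibrationP bg /nerve_fibrationP bf]; apply/nerve_fibrationP.
    by apply: fibration_iso; exists (gmap_id X); split; apply: gmap_eq.
  exact: fibration_comp.
- split=> [X|X Y Z g f wg wf]; first exact: weq_id.
  by have [h _ _] := weq_two_out_of_three g f; apply: h.
- exact: weq_two_out_of_three.
- move=> X Y f iso_f; split; last exact: weq_iso.
  by apply/nerve_fibrationP; apply: fibration_iso.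
- move=> A E B f p _.
  exists (pullback_graph f p), (pullback_fst f p), (pullback_snd f p).
  exact: pullback_graphP.
- move=> P A E B q g f p pb /nerve_fibrationP bp; apply/nerve_fibrationP.
  exact: fibration_pullback pb bp.
- move=> P A E B q g f p pb [/nerve_fibrationP bp wp]; split.
    by apply/nerve_fibrationP; apply: fibration_pullback pb bp.
  exact: weq_pullback pb bp wp.
- exists unit_graph; split=> [X|X f].
    exists (to_unit X); split=> // f _; apply: gmap_eq => x.
    by case: (gfun f x).
  by apply/nerve_fibrationP; apply: fibration_unit.
- move=> X Y f; exists (mpath_graph f), (const_path_map f), (mstop_map f); split.
  + exact: gmap_eq.
  + exact: const_path_weq.
  + by apply/nerve_fibrationP; apply: mstop_fibration.
Qed.
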